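(* Suppose that (A) there exist $s_0<\alpha<\beta<s_1$ with $m(\alpha)=m(\beta)=1$; that $1\le\alpha<2$ if $Q=0$ a.s., and $0<\alpha<2$ if $\mathbb{P}(Q=0)<1$; that $\mathbb{P}(T_j<0)>0$ for some $j\ge 1$; that the measure $\mathbb{P}(\log|T_k|\in\cdot\,,N\ge k)$ is nonlattice for some $k\ge1$; that (B) $\mathbb{E}|Q|^s<\infty$ for all $s<s_1$; and, if $\alpha\ge 1$, that there is $r\in\mathbb{R}$ with $r=r\,\mathbb{E}\big(\sum_{k=1}^N T_k\big)+\mathbb{E}Q$. Let $R$ be the unique solution to $R\stackrel{d}{=}\sum_{k=1}^N T_kR_k+Q$ specified in the context, and let $$K(\beta)=\int_0^\infty\Big(\mathbb{P}(|R|>t)-\sum_{k\ge1}\mathbb{P}(|T_kR_k|>t)\Big)t^{\beta-1}\,dt .$$ Then the following assertions hold. (a) If $\beta>1$ and $\beta<s_\infty$, then either $K(\beta)>0$, or $\mathbb{E}|R|^s<\infty$ for all $s<s_\infty$. (b) If $\beta\le 1$, $\beta<s_\infty$, and $[\beta-\delta_0,1]\subset\mathfrak{D}_{\epsilon_0}$ for some $\delta_0,\epsilon_0>0$, then either $K(\beta)>0$, or $\mathbb{E}|R|^s<\infty$ for all $s<s_\infty$. (c) If $\beta<1$ and $[\beta-\delta_0,\beta]\subset\mathfrak{D}_{\epsilon_0}$ for some $\delta_0,\epsilon_0>0$, then either $K(\beta)>0$, or $\mathbb{E}|R|^s<\infty$ for all $s<\hat s_\infty$.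
   Context: $\mathbf{T}=(Q,(T_k)_{k\ge1})$ is a sequence of real-valued random variables (with arbitrary dependence) such that $N:=\sum_{k\ge1}\mathbf{1}_{\{T_k\ne0\}}$ is a.s. finite and $|T_1|\ge\dots\ge|T_N|>|T_{N+1}|=|T_{N+2}|=\dots=0$. A random variable $R$ (or its law) is a solution of the fixed point equation if $R\stackrel{d}{=}\sum_{k=1}^N T_kR_k+Q$, where $R_1,R_2,\dots$ are iid copies of $R$ independent of $\mathbf{T}$ and $\stackrel{d}{=}$ is equality in distribution. For $s\ge0$ and $\epsilon>0$ put $$m(s)=\mathbb{E}\sum_{k=1}^N|T_k|^s,\qquad \mu(s)=\mathbb{E}\Big(\sum_{k=1}^N|T_k|\Big)^s,\qquad m_\epsilon(s)=\mathbb{E}\Big(\sum_{k=1}^N|T_k|^s\Big)^{1+\epsilon},$$ $\mathfrak{D}=\{s\ge0:m(s)<\infty\}$, $s_0=\inf\mathfrak{D}$, $s_1=\sup\mathfrak{D}$; $s_\infty=\sup\{s\ge0:\mu(s)<\infty\}$; $\mathfrak{D}_\epsilon=\{s\ge0:m_\epsilon(s)<\infty\}$, $s_\epsilon=\sup\mathfrak{D}_\epsilon$; $\hat s_\infty=\min\{1,\lim_{\epsilon\to0}s_\epsilon\}$. Nonlattice means not concentrated on any set $d\mathbb{Z}$ with $d>0$. The solution $R$: if $\alpha<1$, $R$ is the unique (in law) solution with $\mathbb{E}|R|^s<\infty$ for all $s<\beta$; if $\alpha\ge1$ (in which case $\beta>1$), $R$ is the unique (in law) solution with $\mathbb{E}R=r$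 and $\mathbb{E}|R|^s<\infty$ for all $s<\beta$, with $r$ as in the claim. Existence and uniqueness of this solution are known facts under the stated assumptions. *)

(* Defs.v *)
From HB Require Import structures.
From mathcomp Require Import all_boot all_order all_algebra.
From mathcomp Require Import all_classical all_reals all_analysis.
Set Implicit Arguments.
Unset Strict Implicit.
Unset Printing Implicit Defensive.
Import Order.TTheory GRing.Theory Num.Theory.
Import numFieldNormedType.Exports.
Local Open Scope classical_set_scope.
Local Open Scope ring_scope.

(* Sequences are indexed from 0: [T k], [Xs k] are the T_{k+1}, R_{k+1} of the
   mathematics. The solution R is written [X] and its copies [Xs], since [R]
   denotes the real numbers. *)

Definition num_nonzero d (Om : measurableType d) (R : realType)
    (P : probability Om R) (T : nat -> {RV P >-> R}) (w : Om) : \bar R :=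
  (\sum_(0 <= k <oo) ((T k w != 0)%:R : R)%:E)%E.

(* The count N as a natural number, set to 0 on the null set where it is
   infinite. *)
Definition Ncount d (Om : measurableType d) (R : realType)
    (P : probability Om R) (T : nat -> {RV P >-> R}) (w : Om) : nat :=
  Num.truncn (fine (num_nonzero T w)).

(* N is a.s. finite and |T_1| >= ... >= |T_N| > |T_{N+1}| = ... = 0 a.s. *)
Definition ordered_weights d (Om : measurableType d) (R : realType)
    (P : probability Om R) (T : nat -> {RV P >-> R}) : Prop :=
  {ae P, forall w,
    [/\ (num_nonzero T w < +oo)%E,
        (forall i j, (i <= j < Ncount T w)%N -> `|T j w| <= `|T i w|),
        (forall k, (k < Ncount T w)%N -> 0 < `|T k w|) &
        (forall k, (Ncount T w <= k)%N -> `|T k w| = 0)]}.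

Definition eq_in_law d (Om : measurableType d) (R : realType)
    (P : probability Om R) (X Y : Om -> R) : Prop :=
  forall A : set R, measurable A -> P (X @^-1` A) = P (Y @^-1` A).

Definition mutually_independent d (Om : measurableType d) (R : realType)
    (P : probability Om R) (I : eqType) (X : I -> {RV P >-> R}) : Prop :=
  forall (s : seq I) (A : I -> set R), uniq s ->
    (forall i, measurable (A i)) ->
    P (\bigcap_(i in [set` s]) (X i @^-1` A i)) =
    (\prod_(i <- s) P (X i @^-1` A i))%E.

Definition generated_sigma_algebra d (Om : measurableType d) (R : realType)
    (P : probability Om R) (I : Type) (X : I -> {RV P >-> R}) :
    set (set Om) :=
  <<s \bigcup_i preimage_set_system setT (X i) measurable >>.

Definition independent_families d (Om : measurableType d) (R : realType)
    (P : probability Om R) (I J : Type)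
    (X : I -> {RV P >-> R}) (Y : J -> {RV P >-> R}) : Prop :=
  forall A B : set Om,
    generated_sigma_algebra X A -> generated_sigma_algebra Y B ->
    P (A `&` B) = (P A * P B)%E.

(* The family (Q, T_1, T_2, ...) *)
Definition QT_family d (Om : measurableType d) (R : realType)
    (P : probability Om R) (Q : {RV P >-> R}) (T : nat -> {RV P >-> R})
    (o : option nat) : {RV P >-> R} :=
  if o is Some k then T k else Q.

Definition iid_copies d (Om : measurableType d) (R : realType)
    (P : probability Om R) (X : {RV P >-> R}) (Xs : nat -> {RV P >-> R}) :
    Prop :=
  (forall k, eq_in_law P (Xs k) X) /\ mutually_independent Xs.

Definition is_solution d (Om : measurableType d) (R : realType)
    (P : probability Om R) (Q : {RV P >-> R}) (T : nat -> {RV P >-> R})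
    (X : {RV P >-> R}) (Xs : nat -> {RV P >-> R}) : Prop :=
  [/\ iid_copies X Xs,
      independent_families (QT_family Q T) Xs &
      eq_in_law P X (fun w => \sum_(k < Ncount T w) T k w * Xs k w + Q w)].

Definition abs_moment d (Om : measurableType d) (R : realType)
    (P : probability Om R) (X : {RV P >-> R}) (s : R) : \bar R :=
  ('E_P[fun w => (`|X w| `^ s)%R])%E.

Definition m d (Om : measurableType d) (R : realType)
    (P : probability Om R) (T : nat -> {RV P >-> R}) (s : R) : \bar R :=
  ('E_P[fun w => (\sum_(k < Ncount T w) `|T k w| `^ s)%R])%E.

Definition mu d (Om : measurableType d) (R : realType)
    (P : probability Om R) (T : nat -> {RV P >-> R}) (s : R) : \bar R :=
  ('E_P[fun w => ((\sum_(k < Ncount T w) `|T k w|) `^ s)%R])%E.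

Definition m_eps d (Om : measurableType d) (R : realType)
    (P : probability Om R) (T : nat -> {RV P >-> R}) (e s : R) : \bar R :=
  ('E_P[fun w => ((\sum_(k < Ncount T w) `|T k w| `^ s) `^ (1 + e))%R])%E.

Definition D d (Om : measurableType d) (R : realType)
    (P : probability Om R) (T : nat -> {RV P >-> R}) : set R :=
  [set s | 0 <= s /\ (m T s < +oo)%E].

Definition s_0 d (Om : measurableType d) (R : realType)
    (P : probability Om R) (T : nat -> {RV P >-> R}) : \bar R :=
  ereal_inf (EFin @` D T).

Definition s_1 d (Om : measurableType d) (R : realType)
    (P : probability Om R) (T : nat -> {RV P >-> R}) : \bar R :=
  ereal_sup (EFin @` D T).

Definition s_infty d (Om : measurableType d) (R : realType)
    (P : probability Om R) (T : nat -> {RV P >-> R}) : \bar R :=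
  ereal_sup (EFin @` [set s | 0 <= s /\ (mu T s < +oo)%E]).

Definition D_eps d (Om : measurableType d) (R : realType)
    (P : probability Om R) (T : nat -> {RV P >-> R}) (e : R) : set R :=
  [set s | 0 <= s /\ (m_eps T e s < +oo)%E].

Definition s_eps d (Om : measurableType d) (R : realType)
    (P : probability Om R) (T : nat -> {RV P >-> R}) (e : R) : \bar R :=
  ereal_sup (EFin @` D_eps T e).

Definition hat_s_infty d (Om : measurableType d) (R : realType)
    (P : probability Om R) (T : nat -> {RV P >-> R}) : \bar R :=
  Order.min 1%E (lim (s_eps T e @[e --> (0 : R)^'+])).

Definition lattice (R : realType) (h : R) : set R :=
  [set x | exists z : int, x = h * z%:~R].

(* A measure nu on R is concentrated on A when the complement of A is null. *)
Definition nonlattice (R : realType) (nu : set R -> \bar R) : Prop :=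
  forall h : R, 0 < h -> nu (~` lattice h) <> 0%E.

(* The measure P(log|T_k| in . , N >= k). *)
Definition log_weight_measure d (Om : measurableType d) (R : realType)
    (P : probability Om R) (T : nat -> {RV P >-> R}) (k : nat) (A : set R) :
    \bar R :=
  P [set w | A (ln `|T k w|) /\ (k < Ncount T w)%N].

Definition Kconst d (Om : measurableType d) (R : realType)
    (P : probability Om R) (T : nat -> {RV P >-> R})
    (X : {RV P >-> R}) (Xs : nat -> {RV P >-> R}) (beta : R) : \bar R :=
  (\int[@lebesgue_measure R]_(t in `]0%R, +oo[)
     ((P [set w | (t < `|X w|)%R] -
       \sum_(0 <= k <oo) P [set w | (t < `|T k w * Xs k w|)%R]) *
      (t `^ (beta - 1))%:E))%E.

(* Main.v *)
Require Import Defs.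
From HB Require Import structures.
From mathcomp Require Import all_boot all_order all_algebra.
From mathcomp Require Import all_classical all_reals all_analysis.
From mathcomp Require Import measurable_realfun.
From mathcomp Require Import ring lra.
Set Implicit Arguments.
Unset Strict Implicit.
Unset Printing Implicit Defensive.
Import Order.TTheory GRing.Theory Num.Theory.
Import numFieldNormedType.Exports.
Local Open Scope classical_set_scope.
Local Open Scope ring_scope.

(** Let rho = |sum_k T_k X_k + Q|, which is distributed as |X|, and
    a_k = |T_k X_k|. The theorem holds because finiteness of the moments of X
    can be pushed upwards, from one order to slightly larger ones, as soon as
    the moment m of the weights is at least 1 and increasing there.

    Two facts are combined. First, a sum of heavy terms is governed by its
    largest one: rho^s and sum_k a_k^s differ by at most a constant times a
    remainder ([max_term_split]) made of |Q|^s, of a product of |Q| with the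
    power s-1 of the sum, and of products of a_j^p with the power s-p of the
    other terms. Since the weights and the copies are independent, the mean of
    the remainder of order s only involves moments of X of orders p and s-p,
    hence of order strictly below s ([remainder_lty]).

    Secondly, for eta > 0 the function h(t) = t^(q+e) / (1 + eta t^e) satisfies
      h(A x) >= A^q (h(x) + g(x)) - A^(q-e) g(x),
      g(t) = t^(q+e) / (1 + eta t^e)^2
    ([tilt_scale]). Taking A = |T_k|, x = |X_k|, summing and averaging,
      E sum_k h(a_k) >= m(q) E h(|X|) + (m(q) - m(q-e)) E g(|X|),
    whereas the first fact gives E sum_k h(a_k) <= E h(|X|) + C with C
    independent of eta. If E|X|^q is finite, so is E h(|X|); if moreover
    m(q) >= 1 and m(q-e) < m(q), then E g(|X|) is bounded uniformly in eta, and
    letting eta tend to 0 yields E|X|^(q+e) < oo ([moment_step]).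

    At q = beta the moment E|X|^beta is not known to be finite. There h is
    replaced by t^q / eta - h(t), which is bounded by a multiple of t^(q-e);
    the price is the term E(rho^beta - sum_k a_k^beta) / eta, and Fubini's
    theorem identifies this expectation with beta K(beta) ([constantE]). The
    term has the right sign precisely when K(beta) <= 0 ([critical_step]).

    The strict inequality m(q-e) < m(q) for q >= beta and q - e > alpha comes
    from m(alpha) = m(beta) = 1 and from strict convexity of m, which the
    nonlattice hypothesis guarantees ([weight_moment_strict_convex]). Finally,
    if K(beta) > 0 fails, let S be the supremum of the orders of finite moments
    of X: were S below the threshold, a step from S or from just below S would
    pass beyond S ([moments_extend]). The three assertions differ only in the
    exponents p and s that control the remainder. *)

(** * Powers of nonnegative reals *)

Section powers.
Context (R : realType).
Implicit Types (x y z a b s p q r : R).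

(** An intermediate power is controlled by the larger power when the base is at
    least 1 and by the smaller power otherwise. *)
Lemma powR_le_sum x a s b : 0 <= x -> 0 <= a -> a <= s -> s <= b ->
  x `^ s <= x `^ a + x `^ b.
Proof.
move=> x0 a0 as_ sb; have [->|xn0] := eqVneq x 0.
  have [s0|sn0] := eqVneq s 0; last by rewrite (powR0 sn0) addr_ge0 ?powR_ge0.
  have -> : a = 0 by apply/eqP; rewrite eq_le a0 -s0 as_.
  by rewrite s0 !powRr0 lerDl powR_ge0.
have xp : 0 < x by rewrite lt_neqAle eq_sym xn0.
have [x1|x1] := leP 1 x.
  by rewrite (le_trans (ler_powR x1 sb)) // lerDr powR_ge0.
have x01 : 0 < x <= 1 by rewrite xp ltW.
by rewrite (le_trans (ger_powR x01 as_)) // lerDl powR_ge0.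
Qed.

(** A convex function lies above its tangents. After scaling by [y] this is
    Bernoulli's inequality, which is Young's inequality for the product of
    [x / y] with 1. *)
Lemma powR_tangent x y s : 0 <= x -> 0 <= y -> 1 <= s ->
  y `^ s + s * y `^ (s - 1) * (x - y) <= x `^ s.
Proof.
move=> x0 y0 s1; have s0 : 0 < s by lra.
have [->|yn0] := eqVneq y 0.
  have [->|sn1] := eqVneq s 1.
    by rewrite subrr powRr0 !powRr1 // mulr1 mul1r subr0 add0r.
  have sn1' : s - 1 != 0 by rewrite subr_eq0.
  by rewrite (powR0 sn1') powR0 ?gt_eqF // mulr0 mul0r add0r powR_ge0.
have yp : 0 < y by rewrite lt_neqAle eq_sym yn0.
have [->|xn0] := eqVneq x 0.
  rewrite sub0r mulrN -mulrA [_ `^ _ * y]mulrC mulr_powRB1 // powR0 ?gt_eqF //.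
  have := powR_gt0 s yp; nra.
have xp : 0 < x by rewrite lt_neqAle eq_sym xn0.
set u := x / y.
have up : 0 < u by rewrite divr_gt0.
have xE : x = y * u by rewrite /u mulrC divfK.
have H : 1 + s * (u - 1) <= u `^ s.
  have [->|sn1] := eqVneq s 1; first by rewrite (powRr1 (ltW up)); lra.
  have s1' : 0 < s - 1 by rewrite subr_gt0 lt_neqAle eq_sym sn1.
  have := @conjugate_powR R u 1 s (s / (s - 1)) (ltW up) ler01 s0.
  rewrite powR1 mulr1 div1r invf_div => H.
  have {}H : u <= u `^ s / s + (s - 1) / s.
    by apply: H; [rewrite divr_gt0|field; rewrite gt_eqF].
  have : u * s <= (u `^ s / s + (s - 1) / s) * s by rewrite (ler_pM2r s0).
  rewrite mulrDl !divfK ?gt_eqF //; lra.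
have -> : y `^ s + s * y `^ (s - 1) * (x - y) = y `^ s * (1 + s * (u - 1)).
  by rewrite -(mulr_powRB1 y0 s0) xE; ring.
by rewrite [in leRHS]xE powRM // ?(ltW yp) ?(ltW up) // ler_pM2l // powR_gt0.
Qed.

Lemma powR_sub_le x y s : 0 <= y -> y <= x -> 1 <= s ->
  x `^ s - y `^ s <= s * x `^ (s - 1) * (x - y).
Proof. by move=> y0 yx s1; have := powR_tangent y0 (le_trans y0 yx) s1; lra. Qed.

(** Each of the proportions [x / (x + y)] and [y / (x + y)] increases when it is
    raised to a power at most 1, and they add up to 1. *)
Lemma powR_subadd x y p : 0 <= x -> 0 <= y -> 0 < p -> p <= 1 ->
  (x + y) `^ p <= x `^ p + y `^ p.
Proof.
move=> x0 y0 p0 p1; have pn0 : p != 0 by rewrite gt_eqF.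
have [e|xy] := eqVneq (x + y) 0.
  by rewrite e powR0 // addr_ge0 ?powR_ge0.
have xyp : 0 < x + y by rewrite lt_neqAle eq_sym xy addr_ge0.
have key z : 0 <= z -> z <= x + y -> z / (x + y) <= (z / (x + y)) `^ p.
  move=> z0 zxy; have [->|zn0] := eqVneq z 0; first by rewrite mul0r powR_ge0.
  rewrite ger1_powR // divr_gt0 //= ?ler_pdivrMr ?mul1r //.
  by rewrite lt_neqAle eq_sym zn0.
have kx := key x x0 ltac:(lra); have ky := key y y0 ltac:(lra).
have e z : 0 <= z -> z `^ p = (z / (x + y)) `^ p * (x + y) `^ p.
  by move=> z0; rewrite -powRM ?divfK // ?divr_ge0 // ltW.
rewrite (e x) // (e y) // -mulrDl ler_peMl ?powR_ge0 //.
have : x / (x + y) + y / (x + y) = 1 by rewrite -mulrDl divff.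
by lra.
Qed.

Lemma powR_sum_subadd (I : Type) (l : seq I) (P : pred I) (f : I -> R) p :
  (forall i, 0 <= f i) -> 0 < p -> p <= 1 ->
  (\sum_(i <- l | P i) f i) `^ p <= \sum_(i <- l | P i) f i `^ p.
Proof.
move=> f0 p0 p1; elim: l => [|i l IH]; first by rewrite !big_nil powR0 ?gt_eqF.
rewrite !big_cons; case: ifP => // Pi.
apply: (le_trans (powR_subadd _ _ p0 p1)) => //; first by rewrite sumr_ge0.
by rewrite lerD2l.
Qed.

Lemma powR_add_le x y r : 0 <= x -> 0 <= y -> 0 <= r ->
  (x + y) `^ r <= 2 `^ r * (x `^ r + y `^ r).
Proof.
move=> x0 y0 r0.
wlog yx : x y x0 y0 / y <= x.
  move=> H; have [yx|xy] := leP y x; first exact: H.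
  by rewrite addrC [X in _ * X]addrC; apply: H => //; exact: ltW.
apply: (@le_trans _ _ ((2 * x) `^ r)).
  by rewrite ge0_ler_powR // ?nnegrE; lra.
by rewrite powRM // ler_wpM2l ?powR_ge0 // lerDl powR_ge0.
Qed.

(** For [y <= c] the first term suffices; for [y > c] the second one does, as
    the exponent [r - 1] is nonpositive. *)
Lemma powR_concave_le y c r : 0 <= y -> 0 < c -> 0 <= r -> r <= 1 ->
  y `^ r <= c `^ r + c `^ (r - 1) * y.
Proof.
move=> y0 c0 r0 r1; have [yc|cy] := leP y c.
  rewrite (@le_trans _ _ (c `^ r)) ?lerDl ?mulr_ge0 ?powR_ge0 //.
  by rewrite ge0_ler_powR // ?nnegrE // ltW.
have yp : 0 < y by lra.
apply: (@le_trans _ _ (c `^ (r - 1) * y)); last by rewrite lerDr powR_ge0.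
have e z : 0 < z -> z `^ (r - 1) = (z `^ (1 - r))^-1.
  by move=> _; rewrite -powRN opprB.
have -> : y `^ r = y `^ (r - 1) * y.
  by rewrite -{3}(@powRr1 _ y) ?ltW // -powRD ?subrK // (gt_eqF yp) implybT.
rewrite ler_wpM2r ?(ltW yp) // !e // lef_pV2 ?posrE ?powR_gt0 //.
by rewrite ge0_ler_powR // ?nnegrE; lra.
Qed.

(** Jensen's inequality for weights of total mass at most [W]: sum the tangent
    inequalities at the point [(\sum w z) / W]; the missing mass contributes
    with the right sign since [1 <= r]. *)
Lemma powR_mean_le (I : Type) (l : seq I) (P : pred I) (w z : I -> R) W r :
  (forall i, 0 <= w i) -> (forall i, 0 <= z i) -> 0 < W ->
  \sum_(i <- l | P i) w i <= W -> 1 <= r ->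
  (\sum_(i <- l | P i) w i * z i) `^ r
    <= W `^ (r - 1) * \sum_(i <- l | P i) w i * z i `^ r.
Proof.
move=> w0 z0 W0 wW r1; set S := \sum_(i <- l | P i) w i * z i.
have S0 : 0 <= S by apply: sumr_ge0 => i _; rewrite mulr_ge0.
have r0 : 0 < r by lra.
pose y := S / W; have y0 : 0 <= y by rewrite divr_ge0 // ltW.
have SE : S = W * y by rewrite /y mulrC divfK ?gt_eqF.
have H : W * y `^ r <= \sum_(i <- l | P i) w i * z i `^ r.
  pose V := \sum_(i <- l | P i) w i.
  apply: (@le_trans _ _ (V * y `^ r + r * y `^ (r - 1) * (S - V * y))); last first.
    rewrite /V /S !mulr_suml mulrBr !mulr_sumr -sumrB -big_split /=.
    apply: ler_sum => i _.
    have := powR_tangent (z0 i) y0 r1; have := w0 i; nra.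
  rewrite [in S - _]SE.
  have -> : r * y `^ (r - 1) * (W * y - V * y) = (y * y `^ (r - 1)) * (r * (W - V)).
    by ring.
  rewrite mulr_powRB1 //; have := powR_ge0 y r.
  rewrite -/V in wW; move=> yr0.
  have : 0 <= y `^ r * ((r - 1) * (W - V)) by rewrite !mulr_ge0 // subr_ge0.
  by nra.
rewrite [in leLHS]SE powRM // ?(ltW W0) // -(mulr_powRB1 (ltW W0) r0).
by rewrite [W * _]mulrC -mulrA ler_wpM2l ?powR_ge0.
Qed.
End powers.

(** * Sums close to their largest term *)

Section finite_sums.
Context (R : realType).
Implicit Types (x y z a b s p q r : R).

Definition pow_sum n (a : nat -> R) p := \sum_(k < n) a k `^ p.

Lemma pow_sum_ge0 n (a : nat -> R) p : 0 <= pow_sum n a p.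
Proof. by apply: sumr_ge0 => k _; exact: powR_ge0. Qed.

(** The factors [A] and [z] get separated, so that independence can be used
    later, and the only power of [A k] is the [p]-th one. Subadditivity of the
    [p]-th power reduces the left-hand side to the power [q / p] of a weighted
    sum with weights [A k `^ p] of total mass at most [pow_sum n A p]; then
    concavity applies if [q <= p], and Jensen's inequality otherwise. *)
Lemma powR_wsum_le n (P : pred 'I_n) (A z : nat -> R) p q :
  (forall k, 0 <= A k) -> (forall k, 0 <= z k) -> 0 < p -> p <= 1 -> 0 <= q ->
  (\sum_(k < n | P k) A k * z k) `^ q <=
  pow_sum n A p `^ (q / p) +
  pow_sum n A p `^ (q / p - 1) * \sum_(k < n | P k) A k `^ p * (z k `^ p + z k `^ q).
Proof.
move=> A0 z0 p0 p1 q0; set W := pow_sum n A p.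
have r0 : 0 <= q / p by rewrite divr_ge0 // ltW.
have pq : p * (q / p) = q by rewrite mulrC divfK ?gt_eqF.
have Az0 k : 0 <= A k * z k by rewrite mulr_ge0.
have W0 : 0 <= W by apply: sumr_ge0 => k _; exact: powR_ge0.
pose S := \sum_(k < n | P k) A k `^ p * z k `^ p.
have S0 : 0 <= S by apply: sumr_ge0 => k _; rewrite mulr_ge0 ?powR_ge0.
have step1 : (\sum_(k < n | P k) A k * z k) `^ q <= S `^ (q / p).
  rewrite -{1}pq powRrM ge0_ler_powR ?nnegrE ?powR_ge0 //.
  rewrite (le_trans (@powR_sum_subadd R _ _ _ (fun k : 'I_n => A k * z k) p _ p0 p1)) //.
  by apply: ler_sum => k _; rewrite powRM.
apply: (le_trans step1).
have wz0 k : 0 <= A k `^ p * (z k `^ p + z k `^ q).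
  by rewrite mulr_ge0 ?addr_ge0 ?powR_ge0.
have [W00|Wn0] := eqVneq W 0.
  have Ak0 (k : 'I_n) : A k `^ p = 0.
    have := W00; rewrite /W /pow_sum; move/eqP; rewrite psumr_eq0; last by move=> *;
      exact: powR_ge0.
    by move/allP => /(_ k); rewrite mem_index_enum => /(_ isT) /eqP.
  have -> : S = 0 by rewrite /S big1 // => k _; rewrite Ak0 mul0r.
  rewrite W00 lerDl mulr_ge0 ?powR_ge0 // sumr_ge0 // => k _.
have Wp : 0 < W by rewrite lt_neqAle eq_sym Wn0.
have [r1|r1] := leP (q / p) 1.
  apply: (le_trans (powR_concave_le S0 Wp r0 r1)).
  rewrite lerD2l ler_wpM2l ?powR_ge0 // /S.
  by apply: ler_sum => k _; rewrite ler_wpM2l ?powR_ge0 // lerDl powR_ge0.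
have wW : \sum_(k < n | P k) A k `^ p <= W.
  rewrite /W /pow_sum [leRHS](bigID P) /= lerDl sumr_ge0 // => k _; exact: powR_ge0.
have := @powR_mean_le R _ (index_enum 'I_n) P (fun k => A k `^ p) (fun k => z k `^ p)
  W (q / p) _ _ Wp wW (ltW r1).
move/(_ (fun=> powR_ge0 _ _) (fun=> powR_ge0 _ _))/le_trans; apply.
rewrite (@le_trans _ _ (W `^ (q / p - 1) *
  \sum_(k < n | P k) A k `^ p * (z k `^ p + z k `^ q))) ?lerDr ?powR_ge0 //.
rewrite ler_wpM2l ?powR_ge0 // ler_sum // => k _.
by rewrite ler_wpM2l ?powR_ge0 // -powRrM pq lerDr powR_ge0.
Qed.

Definition max_const s := 2 + 2 * s * 4 `^ s.

(** Every summand is a product of powers of distinct terms, so that over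
    independent terms its expectation only involves moments of orders at most
    [p] or [s - p] of a single one, although the total degree is [s]. *)
Definition offdiag n (a : nat -> R) p s :=
  \sum_(j < n) a j `^ p * (\sum_(k < n | k != j) a k) `^ (s - p).

Lemma powR_dist_le_small (u v : R) s : 0 < s -> s <= 1 ->
  `| `|u| `^ s - `|v| `^ s | <= `|u - v| `^ s.
Proof.
move=> s0 s1.
wlog uv : u v / `|v| <= `|u|.
  move=> H; have [|/ltW] := leP `|v| `|u|; first exact: H.
  by move=> /H; rewrite distrC [`|v - u|]distrC.
rewrite ger0_norm; last first.
  by rewrite subr_ge0 ge0_ler_powR // ?nnegrE // ltW.
rewrite lerBlDr (le_trans _ (powR_subadd _ _ s0 s1)) //.
rewrite ge0_ler_powR ?nnegrE ?addr_ge0 //; first exact: ltW.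
by rewrite -{1}(subrK v u) ler_normD.
Qed.

Lemma powR_dist_le_large (u v : R) s : 0 <= u -> 0 <= v -> 1 <= s ->
  `| u `^ s - v `^ s | <= s * `|u - v| * (Num.max u v) `^ (s - 1).
Proof.
move=> u0 v0 s1.
wlog uv : u v u0 v0 / v <= u.
  move=> H; have [|/ltW] := leP v u => uv.
    by have := H _ _ u0 v0 uv; rewrite (max_l uv).
  rewrite (distrC u v) (distrC (u `^ s)).
    by have := H _ _ v0 u0 uv; rewrite (max_l uv).
rewrite (max_l uv) (ger0_norm (x := u - v)) ?subr_ge0 // ger0_norm; last first.
  by rewrite subr_ge0 ge0_ler_powR // ?nnegrE //; lra.
by rewrite mulrAC; exact: powR_sub_le.
Qed.

(** [M] is the largest of the numbers [a k], and [J] selects all indices but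
    one where it is attained ([M] is 0 if there is no index). Every term
    selected by [J] is at most the sum of the terms of other indices, whence the
    bound by [offdiag]. The power of the full sum is compared with that of its
    largest term by subadditivity if [s <= 1], and by the mean value inequality
    otherwise; in the latter case the derivative is a power [s - 1] of the whole
    sum, and splitting off the largest term [M] leaves products of distinct
    terms. *)
Lemma max_term_split n (x : nat -> R) y p s :
  0 < p -> p <= 1 -> p <= s ->
  let a k : R := `|x k| in
  exists M, exists J : pred 'I_n, [/\ 0 <= M,
    (forall f : R -> R, f 0 = 0 ->
      \sum_(k < n) f (a k) = f M + \sum_(k < n | J k) f (a k)) &
    \sum_(k < n | J k) a k `^ s + `| `|\sum_(k < n) x k + y| `^ s - M `^ s| <=
    max_const s * (`|y| `^ s
      + (if 1 < s then `|y| * (\sum_(k < n) a k) `^ (s - 1) else 0)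
      + offdiag n a p s)].
Proof.
move=> p0 p1 ps a; have s0 : 0 < s by lra.
have C1 : 2 <= max_const s by rewrite /max_const lerDl !mulr_ge0 ?powR_ge0 // ltW.
have a0 k : 0 <= a k by exact: normr_ge0.
have off0 : 0 <= offdiag n a p s.
  by apply: sumr_ge0 => j _; rewrite mulr_ge0 ?powR_ge0.
have Q0 : 0 <= if 1 < s then `|y| * (\sum_(k < n) a k) `^ (s - 1) else 0.
  by case: ifP => // _; rewrite mulr_ge0 ?powR_ge0.
case: n off0 Q0 => [|n] off0 Q0.
  exists 0, predT; split => //.
    by move=> f f0; rewrite !big_ord0 f0 addr0.
  rewrite !big_ord0 !add0r (powR0 (x := s)) ?gt_eqF // subr0 ger0_norm ?powR_ge0 //.
  rewrite (@le_trans _ _ (1 * `|y| `^ s)) ?mul1r //.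
  rewrite -[X in X <= _]mul1r ler_pM ?powR_ge0 //; first lra.
  by rewrite big_ord0 in Q0; rewrite -addrA lerDl addr_ge0.
pose K := [arg max_(i > ord0 : 'I_n.+1) a i]%O.
have KM (k : 'I_n.+1) : a k <= a K by rewrite /K; case: arg_maxP => // i _; apply.
exists (a K), (fun k => k != K); split => //.
  by move=> f _; rewrite (bigD1 K).
set S := \sum_(k < n.+1 | _) _.
set Y : R := \sum_(k < n.+1) a k in Q0 *.
set B := offdiag _ _ _ _ in off0 *.
pose Yj (j : 'I_n.+1) : R := \sum_(k < n.+1 | k != j) a k.
have Yj0 j : 0 <= Yj j by apply: sumr_ge0.
have aYj (j : 'I_n.+1) : j != K -> a j <= Yj j.
  move=> jK; rewrite (le_trans (KM j)) // /Yj (bigD1 K) 1?eq_sym //=.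
  by rewrite lerDl sumr_ge0.
have YE (j : 'I_n.+1) : Y = a j + Yj j by rewrite /Y (bigD1 j).
have SB : S <= B.
  rewrite /B /offdiag [leRHS](bigID (fun k => k != K)) /= ler_wpDr //.
    by apply: sumr_ge0 => j _; rewrite mulr_ge0 ?powR_ge0.
  apply: ler_sum => j jK; rewrite -/(Yj j).
  have -> : a j `^ s = a j `^ p * a j `^ (s - p).
    by rewrite -powRD ?[p + _]addrC ?subrK // gt_eqF.
  rewrite ler_wpM2l ?powR_ge0 // ge0_ler_powR ?nnegrE ?subr_ge0 //.
  exact: aYj.
pose Z := \sum_(k < n.+1 | k != K) a k.
have YZ : Y = a K + Z by exact: YE.
have Z0 : 0 <= Z by exact: Yj0.
have dxy : `|\sum_(k < n.+1) x k + y - x K| <= `|y| + Z.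
  rewrite (bigD1 K) //=.
  have -> : x K + \sum_(i < n.+1 | i != K) x i + y - x K =
    y + \sum_(i < n.+1 | i != K) x i by ring.
  by rewrite (le_trans (ler_normD _ _)) // lerD2l ler_norm_sum.
have [s1|s1] := leP s 1.
  rewrite addr0.
  apply: (@le_trans _ _ (S + (`|y| `^ s + S))).
    rewrite lerD2l (le_trans (powR_dist_le_small _ _ s0 s1)) //.
    rewrite (@le_trans _ _ ((`|y| + Z) `^ s)) //.
      by rewrite ge0_ler_powR ?nnegrE ?addr_ge0 // ltW.
    rewrite (le_trans (powR_subadd _ _ s0 s1)) // lerD2l.
    exact: powR_sum_subadd.
  have y0 := powR_ge0 `|y| s.
  have : 0 <= (max_const s - 2) * (`|y| `^ s + B).
    by rewrite mulr_ge0 ?subr_ge0 ?addr_ge0.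
  lra.
set b : R := `|y| in dxy *.
have b0 : 0 <= b by exact: normr_ge0.
have Y0 : 0 <= Y by rewrite YZ addr_ge0.
have s10 : 0 <= s - 1 by lra.
(* [c] pays for splitting the power [s - 1] of a sum of two terms; it is paid
   twice, for the whole sum and for each [Yj], whence [4 `^ s] in [max_const]. *)
pose c : R := 2 `^ (s - 1).
have c1 : 1 <= c by rewrite /c -[leLHS](powRr0 2) ler_powR //; lra.
set u := Y `^ (s - 1).
have u0 : 0 <= u by exact: powR_ge0.
pose v := b `^ (s - 1).
have v0 : 0 <= v by exact: powR_ge0.
have bv : b * v = b `^ s by exact: mulr_powRB1.
have Zu : Z * u <= c * B.
  rewrite /Z mulr_suml /B /offdiag mulr_sumr [leRHS](bigID (fun k => k != K)) /=.
  rewrite ler_wpDr //.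
    by apply: sumr_ge0 => j _; rewrite !mulr_ge0 ?powR_ge0.
  apply: ler_sum => j jK; rewrite -/(Yj j).
  have [aj0|aj0] := eqVneq (a j) 0.
    by rewrite aj0 mul0r !mulr_ge0 ?powR_ge0.
  have ajp : 0 < a j by rewrite lt_neqAle eq_sym aj0 a0.
  have Yjp : 0 < Yj j by exact: lt_le_trans (aYj _ jK).
  have h1 : u <= c * Yj j `^ (s - 1).
    rewrite /u /c -powRM // ge0_ler_powR ?nnegrE ?mulr_ge0 //.
    by rewrite (YE j); have := aYj _ jK; lra.
  have h2 : a j * Yj j `^ (s - 1) <= a j `^ p * Yj j `^ (s - p).
    have -> : s - p = (1 - p) + (s - 1) by ring.
    rewrite [X in _ <= _ * X]powRD; last by rewrite (gt_eqF Yjp) implybT.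
    rewrite mulrA ler_wpM2r ?powR_ge0 //.
    rewrite [leLHS](_ : _ = a j `^ p * a j `^ (1 - p)); last first.
      by rewrite -powRD ?aj0 ?implybT // addrC subrK powRr1.
    rewrite ler_wpM2l ?powR_ge0 // ge0_ler_powR ?nnegrE ?subr_ge0 //.
    exact: aYj.
  apply: (le_trans (ler_wpM2l (a0 j) h1)).
  by rewrite mulrCA ler_wpM2l //; lra.
(* If [b] exceeds [Y], it also exceeds [Z], and [Z * v] is absorbed by [b `^ s]. *)
have Zv : Z * v <= Z * u + b `^ s.
  have [bY|Yb] := leP b Y.
    rewrite (@le_trans _ _ (Z * u)) ?lerDl ?powR_ge0 //.
    by rewrite ler_wpM2l // ge0_ler_powR ?nnegrE.
  rewrite (@le_trans _ _ (b `^ s)) ?lerDr ?mulr_ge0 //.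
  rewrite -bv ler_wpM2r //; have := a0 K; lra.
have rho : `|\sum_(k < n.+1) x k + y| <= Y + b.
  by rewrite (le_trans (ler_normD _ _)) // lerD2r ler_norm_sum.
have aKY : a K <= Y + b by lra.
have D1 : `| `|\sum_(k < n.+1) x k + y| `^ s - a K `^ s| <=
    s * (b + Z) * (c * (u + v)).
  apply: (le_trans (powR_dist_le_large _ _ (ltW s1))) => //.
  apply: ler_pM; rewrite ?mulr_ge0 ?powR_ge0 ?(ltW s0) //.
    rewrite ler_wpM2l ?(ltW s0) // (le_trans _ dxy) //; exact: ler_dist_dist.
  rewrite (le_trans _ (powR_add_le Y0 b0 s10)) //.
  apply: ge0_ler_powR; rewrite ?nnegrE ?(addr_ge0 Y0 b0) //.
    by rewrite le_max normr_ge0.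
  by rewrite ge_max rho aKY.
apply: (le_trans (lerD SB D1)).
have cc : c * c <= 4 `^ s.
  rewrite /c -powRM // (_ : 2 * 2 = 4) ?ler_powR //; lra.
have cs : 0 <= c * s by rewrite mulr_ge0 ?(ltW s0) //; lra.
have bs0 : 0 <= b `^ s by exact: powR_ge0.
have bu0 : 0 <= b * u by rewrite mulr_ge0.
have e1 : s * (b + Z) * (c * (u + v)) <= c * s * (b * u + 2 * b `^ s + 2 * (c * B)).
  have -> : s * (b + Z) * (c * (u + v)) = c * s * (b * u + b * v + Z * u + Z * v).
    by ring.
  by rewrite ler_wpM2l // bv; lra.
have e2 : c * s * (b * u + 2 * b `^ s + 2 * (c * B)) <=
    2 * s * (c * c) * (b `^ s + b * u + B).
  have -> : 2 * s * (c * c) * (b `^ s + b * u + B) =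
    c * s * (2 * (c * (b `^ s)) + 2 * (c * (b * u)) + 2 * (c * B)) by ring.
  rewrite ler_wpM2l //.
  have : 0 <= (c - 1) * b `^ s by rewrite mulr_ge0 ?subr_ge0.
  have : 0 <= (c - 1) * (b * u) by rewrite mulr_ge0 ?subr_ge0.
  lra.
have e3 : 2 * s * (c * c) * (b `^ s + b * u + B) <=
    2 * s * 4 `^ s * (b `^ s + b * u + B).
  by rewrite ler_wpM2r ?addr_ge0 // ler_wpM2l // mulr_ge0 // ltW.
rewrite /max_const; lra.
Qed.

End finite_sums.

(** * Tilted test functions *)

Section test_functions.
Context (R : realType).
Implicit Types (t x u v q e eta A : R).

(** [tilt] interpolates between [t `^ (q + e)] for small [t] and
    [t `^ q / eta] for large [t]; [defect] is its distance to the latter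
    ([tilt_defect]), and [gain] is what scaling the argument of [tilt] gains. *)
Definition tilt q e eta t : R := t `^ (q + e) / (1 + eta * t `^ e).
Definition gain q e eta t : R := t `^ (q + e) / (1 + eta * t `^ e) ^+ 2.
Definition defect q e eta t : R := t `^ q / (eta * (1 + eta * t `^ e)).

Lemma damp_gt0 eta t e : 0 <= eta -> 0 < 1 + eta * t `^ e.
Proof. by move=> e0; rewrite ltr_wpDr // mulr_ge0 ?powR_ge0. Qed.

Lemma tilt_ge0 q e eta t : 0 <= eta -> 0 <= tilt q e eta t.
Proof. by move=> e0; rewrite divr_ge0 ?powR_ge0 // ltW ?damp_gt0. Qed.

Lemma gain_ge0 q e eta t : 0 <= eta -> 0 <= gain q e eta t.
Proof. by move=> e0; rewrite divr_ge0 ?powR_ge0 // exprn_ge0 // ltW ?damp_gt0. Qed.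

Lemma defect_ge0 q e eta t : 0 <= eta -> 0 <= defect q e eta t.
Proof.
by move=> e0; rewrite divr_ge0 ?powR_ge0 // mulr_ge0 // ltW ?damp_gt0.
Qed.

Lemma powR_addE t q e : 0 < q -> 0 < e -> t `^ (q + e) = t `^ q * t `^ e.
Proof.
move=> q0 e0; rewrite powRD //; apply/implyP; rewrite gt_eqF //; exact: addr_gt0.
Qed.

Lemma tilt_defect q e eta t : 0 < q -> 0 < e -> 0 < eta ->
  tilt q e eta t = t `^ q / eta - defect q e eta t.
Proof.
move=> q0 e0 eta0; rewrite /tilt /defect powR_addE //.
have := damp_gt0 t e (ltW eta0) => D; field.
by rewrite !gt_eqF.
Qed.

Lemma tilt_le_powR q e eta t : 0 <= eta -> tilt q e eta t <= t `^ (q + e).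
Proof.
move=> e0; rewrite /tilt ler_pdivrMr ?damp_gt0 // ler_peMr ?powR_ge0 //.
by rewrite lerDl mulr_ge0 ?powR_ge0.
Qed.

Lemma tilt_le_powR_div q e eta t : 0 < q -> 0 < e -> 0 < eta ->
  tilt q e eta t <= t `^ q / eta.
Proof.
by move=> q0 e0 eta0; rewrite tilt_defect // lerBlDr lerDl defect_ge0 // ltW.
Qed.

Lemma gain_le_tilt q e eta t : 0 <= eta -> gain q e eta t <= tilt q e eta t.
Proof.
move=> e0; rewrite /gain /tilt ler_wpM2l ?powR_ge0 //.
rewrite lef_pV2 ?posrE ?exprn_gt0 ?damp_gt0 // expr2 ler_peMr ?(ltW (damp_gt0 _ _ e0)) //.
by rewrite lerDl mulr_ge0 ?powR_ge0.
Qed.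

Lemma defect_le q e eta t : 0 < eta -> 0 < e -> e < q -> 0 <= t ->
  defect q e eta t <= t `^ (q - e) / eta ^+ 2.
Proof.
move=> eta0 e0 eq t0; rewrite /defect; have -> : t `^ q = t `^ (q - e) * t `^ e.
  by rewrite -powR_addE ?subrK // subr_gt0.
have D := damp_gt0 t e (ltW eta0).
rewrite ler_pdivrMr ?mulr_gt0 // -!mulrA ler_wpM2l ?powR_ge0 //.
rewrite expr2 invfM -mulrA mulKf ?gt_eqF // mulrDr mulr1 mulKf ?gt_eqF //.
by rewrite lerDr invr_ge0 ltW.
Qed.

Lemma gain_le q e eta t : 0 < eta -> 0 < e -> e < q -> 0 <= t ->
  gain q e eta t <= t `^ (q - e) / eta ^+ 2.
Proof.
move=> eta0 e0 eq t0.
rewrite /gain; have D := damp_gt0 t e (ltW eta0).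
have q0 : 0 < q by lra.
have tq : t `^ q = t `^ (q - e) * t `^ e by rewrite -powR_addE ?subrK // subr_gt0.
rewrite (powR_addE t q0 e0) tq.
rewrite -!mulrA ler_wpM2l ?powR_ge0 // mulrA -expr2 -exprVn -exprMn -exprVn.
rewrite lerXn2r ?nnegrE ?divr_ge0 ?invr_ge0 ?powR_ge0 ?(ltW D) ?(ltW eta0) //.
rewrite ler_pdivrMr // mulrDr mulr1 mulKf ?gt_eqF //.
by rewrite lerDr invr_ge0 ltW.
Qed.

(** With [v = A `^ e] and [u = x `^ e] the difference of the two sides is a
    nonnegative multiple of the square [(v - 1) ^+ 2]. *)
Lemma tilt_scale q e eta A x : 0 < e -> e < q -> 0 < eta -> 0 <= A -> 0 <= x ->
  A `^ q * (tilt q e eta x + gain q e eta x) <=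
  tilt q e eta (A * x) + A `^ (q - e) * gain q e eta x.
Proof.
move=> e0 eq eta0 A0 x0; have q0 : 0 < q by lra.
have qe0 : 0 < q - e by lra.
have [->|An0] := eqVneq A 0.
  have qe' : 0 < q + e by lra.
  by rewrite mul0r /tilt !powR0 ?(gt_eqF qe') ?(gt_eqF qe0) ?(gt_eqF q0) ?(gt_eqF e0) // !mul0r add0r.
have Ap : 0 < A by rewrite lt_neqAle eq_sym An0.
rewrite /tilt /gain powRM // [(A * x) `^ e]powRM //.
rewrite (powR_addE x q0 e0) (powR_addE A q0 e0).
have -> : A `^ q = A `^ (q - e) * A `^ e by rewrite -powR_addE ?subrK.
set a := A `^ (q - e); set v := A `^ e; set u := x `^ e; set y := x `^ q.
have a0 : 0 <= a by exact: powR_ge0.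
have v0 : 0 < v by exact: powR_gt0.
have u0 : 0 <= u by exact: powR_ge0.
have y0 : 0 <= y by exact: powR_ge0.
have d1 : 0 < 1 + eta * u by rewrite ltr_wpDr // mulr_ge0 // ltW.
have d2 : 0 < 1 + eta * (v * u) by rewrite ltr_wpDr // !mulr_ge0 // ltW.
rewrite -subr_ge0.
suff -> : a * v * v * (y * u) / (1 + eta * (v * u)) + a * (y * u / (1 + eta * u) ^+ 2)
  - a * v * (y * u / (1 + eta * u) + y * u / (1 + eta * u) ^+ 2) =
  a * y * u * (v - 1) ^+ 2 / ((1 + eta * u) ^+ 2 * (1 + eta * (v * u))).
  apply: divr_ge0; apply: mulr_ge0; rewrite ?sqr_ge0 ?(ltW d2) //.
  by rewrite !mulr_ge0.
field; by rewrite !gt_eqF.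
Qed.

Lemma defect_scale q e eta A x : 0 < e -> e < q -> 0 < eta -> 0 <= A -> 0 <= x ->
  defect q e eta (A * x) + A `^ q * gain q e eta x <=
  A `^ q * defect q e eta x + A `^ (q - e) * gain q e eta x.
Proof.
move=> e0 eq eta0 A0 x0; have q0 : 0 < q by lra.
have := tilt_scale e0 eq eta0 A0 x0.
rewrite !tilt_defect // powRM //; set y := x `^ q; set a := A `^ q; nra.
Qed.

Lemma tilt_homo q e eta x y : 0 < q -> 0 < e -> 0 < eta -> 0 <= x -> x <= y ->
  tilt q e eta x <= tilt q e eta y.
Proof.
move=> q0 e0 eta0 x0 xy; have y0 : 0 <= y by lra.
have D z := damp_gt0 z e (ltW eta0).
rewrite /tilt !powR_addE // -!mulrA ler_pM ?powR_ge0 ?divr_ge0 ?powR_ge0 ?(ltW (D _)) //.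
  by rewrite ge0_ler_powR ?nnegrE // ltW.
have uv : x `^ e <= y `^ e by rewrite ge0_ler_powR ?nnegrE // ltW.
rewrite ler_pdivrMr // mulrAC ler_pdivlMr //; nra.
Qed.

(** A positive left-hand side means [y < x], and the denominator of [tilt]
    is at least 1 and increases. *)
Lemma tilt_sub_le q e eta x y : 0 < q -> 0 < e -> 0 < eta -> 0 <= x -> 0 <= y ->
  tilt q e eta x - tilt q e eta y <= `|x `^ (q + e) - y `^ (q + e)|.
Proof.
move=> q0 e0 eta0 x0 y0; have [xy|yx] := leP x y.
  rewrite (@le_trans _ _ 0) // subr_le0; exact: tilt_homo.
have D z := damp_gt0 z e (ltW eta0).
have qe : 0 <= q + e by lra.
have xy' : y `^ (q + e) <= x `^ (q + e) by rewrite ge0_ler_powR ?nnegrE // ltW.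
have uv : y `^ e <= x `^ e by rewrite ge0_ler_powR ?nnegrE // ltW.
rewrite ger0_norm ?subr_ge0 //.
apply: (@le_trans _ _ ((x `^ (q + e) - y `^ (q + e)) / (1 + eta * x `^ e))); last first.
  rewrite ler_pdivrMr // ler_peMr ?subr_ge0 //.
  by rewrite lerDl mulr_ge0 ?powR_ge0 // ltW.
rewrite /tilt [in leRHS]mulrBl; rewrite lerD2l lerN2 ler_wpM2l ?powR_ge0 // lef_pV2 ?posrE //.
by rewrite lerD2l ler_wpM2l // ltW.
Qed.

End test_functions.

(** * Independence and sums of random length *)

Section independence.
Context d (Om : measurableType d) (R : realType) (P : probability Om R).

(** The joint law of [f] and [g] is the product of their laws, because it agrees
    with it on rectangles; the rest is Tonelli's theorem. *)
Lemma integralM_indep (f g : Om -> R) :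
  measurable_fun setT f -> measurable_fun setT g ->
  (forall w, 0 <= f w) -> (forall w, 0 <= g w) ->
  (forall A B : set R, measurable A -> measurable B ->
     P (f @^-1` A `&` g @^-1` B) = (P (f @^-1` A) * P (g @^-1` B))%E) ->
  (\int[P]_w (f w * g w)%:E = (\int[P]_w (f w)%:E) * (\int[P]_w (g w)%:E))%E.
Proof.
move=> mf mg f0 g0 fg.
have mfg : measurable_fun setT (fun w => (f w, g w)) by exact: measurable_fun_pair.
pose F : {mfun Om >-> R} := HB.pack f (isMeasurableFun.Build _ _ _ _ _ mf).
pose G : {mfun Om >-> R} := HB.pack g (isMeasurableFun.Build _ _ _ _ _ mg).
pose FG : {mfun Om >-> (R * R)%type} :=
  HB.pack (fun w => (f w, g w)) (isMeasurableFun.Build _ _ _ _ _ mfg).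
have uniq := @product_measure_unique _ _ _ _ _ (distribution P F) (distribution P G)
  (distribution P FG) fg.
pose h (z : R * R) : \bar R := (`|z.1| * `|z.2|)%:E.
have mh : measurable_fun setT h.
  apply/measurable_EFinP; apply: measurable_funM; apply: measurableT_comp => //.
have h0 z : (0 <= h z)%E by rewrite lee_fin mulr_ge0.
transitivity (\int[distribution P FG]_z h z)%E.
  rewrite ge0_integral_distribution //; apply: eq_integral => w _ /=.
  by rewrite /h /= !ger0_norm.
transitivity (\int[distribution P F \x distribution P G]_z h z)%E.
  by apply: eq_measure_integral => A mA _; rewrite -uniq.
rewrite fubini_tonelli1 // /fubini_F.
transitivity (\int[distribution P F]_x (`|x|%:E * \int[P]_w (g w)%:E))%E.
  apply: eq_integral => x _; rewrite /h /=.
  under eq_integral do rewrite EFinM.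
  rewrite ge0_integralZl_EFin //; last first.
    by apply/measurable_EFinP; exact: normr_measurable.
  congr (_ * _)%E; rewrite ge0_integral_distribution //.
    by apply: eq_integral => w _ /=; rewrite ger0_norm.
  by apply/measurable_EFinP; exact: normr_measurable.
have ig0 : (0 <= \int[P]_w (g w)%:E)%E by apply: integral_ge0 => w _; rewrite lee_fin.
have mn : measurable_fun setT (fun x : R => `|x|%:E).
  by apply/measurable_EFinP; exact: normr_measurable.
rewrite ge0_integralZr // ge0_integral_distribution //.
by congr (_ * _)%E; apply: eq_integral => w _ /=; rewrite ger0_norm.
Qed.

Lemma measurable_wrt (G : set (set Om)) (f : Om -> R) :
  G `<=` measurable -> measurable_fun setT (f : g_sigma_algebraType G -> R) ->
  measurable_fun setT f.
Proof.
move=> Gm mf _ A mA; have := mf measurableT A mA; rewrite !setTI => H.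
move: H; apply: smallest_sub => //; exact: sigma_algebra_measurable.
Qed.

Lemma measurable_wrt_preimage (G : set (set Om)) (f : Om -> R) A :
  measurable_fun setT (f : g_sigma_algebraType G -> R) -> measurable A ->
  <<s G >> (f @^-1` A).
Proof. by move=> mf mA; have := mf measurableT A mA; rewrite setTI. Qed.

Lemma integral_eq_in_law (X Y : Om -> R) (f : R -> R) :
  measurable_fun setT X -> measurable_fun setT Y -> eq_in_law P X Y ->
  measurable_fun setT f -> (forall x, 0 <= f x) ->
  (\int[P]_w (f (X w))%:E = \int[P]_w (f (Y w))%:E)%E.
Proof.
move=> mX mY XY mf f0.
pose F : {mfun Om >-> R} := HB.pack X (isMeasurableFun.Build _ _ _ _ _ mX).
pose G : {mfun Om >-> R} := HB.pack Y (isMeasurableFun.Build _ _ _ _ _ mY).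
have mf' : measurable_fun setT (EFin \o f) by exact/measurable_EFinP.
have f0' x : (0 <= (EFin \o f) x)%E by rewrite lee_fin.
have := @ge0_integral_distribution _ _ _ _ _ P F (EFin \o f) mf' f0'.
have := @ge0_integral_distribution _ _ _ _ _ P G (EFin \o f) mf' f0'.
move=> /= <- <-; apply: eq_measure_integral => A mA _; exact: XY.
Qed.

End independence.

Section random_sums.
Context d (Om : measurableType d) (R : realType).
Implicit Types (N : Om -> nat) (F : nat -> Om -> R).

(** The number of nonzero terms, as in [Ncount] but for plain functions, so
    that its measurability can be stated with respect to any sigma-algebra on
    the sample space. *)
Definition count_of (T : nat -> Om -> R) (w : Om) : nat :=
  Num.truncn (fine (\sum_(0 <= k <oo) ((T k w != 0)%:R : R)%:E)%E).

(** Measurability of an integer-valued [N], through the events on which an index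
    is smaller than [N]: these are the ones that occur in sums of length [N]. *)
Definition measurable_count N := forall k, measurable [set w | (k < N w)%N].

Lemma measurable_count_of (T : nat -> Om -> R) :
  (forall k, measurable_fun setT (T k)) -> measurable_count (count_of T).
Proof.
move=> mT k.
pose e w : \bar R := (\sum_(0 <= k <oo) ((T k w != 0)%:R : R)%:E)%E.
have me : measurable_fun setT e.
  apply: ge0_emeasurable_sum => [n w _ _|n _]; first by rewrite lee_fin ler0n.
  apply/measurable_EFinP.
  rewrite (_ : (fun w => _) = \1_(T n @^-1` [set~ 0])); last first.
    apply/funext => w; rewrite indicE; congr (_%:R).
    by congr nat_of_bool; apply/idP/idP => [/eqP ?|]; rewrite inE //= => /eqP.
  apply: measurable_indic; rewrite -(setTI (_ @^-1` _)); apply: mT => //.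
  exact: measurableC.
have mfe : measurable_fun setT (fine \o e) by apply: measurableT_comp.
rewrite (_ : [set w | _] = setT `&` (fine \o e) @^-1` `[k.+1%:R, +oo[%classic).
  exact: mfe.
rewrite setTI; apply/seteqP; split=> w;
  by rewrite /= in_itv /= andbT /count_of truncn_gt_nat.
Qed.

Definition ltN N k w : R := (k < N w)%N%:R.

Lemma ltN_ge0 N k w : 0 <= ltN N k w. Proof. exact: ler0n. Qed.

Lemma measurable_ltN N k : measurable_count N -> measurable_fun setT (ltN N k).
Proof.
move=> mN; rewrite (_ : ltN N k = \1_[set w | (k < N w)%N]).
  exact: measurable_indic.
apply/funext => w; rewrite indicE /ltN; congr (_%:R).
by congr nat_of_bool; apply/idP/idP => [?|]; rewrite inE.
Qed.

Lemma random_sum_ltN N F w n : (N w <= n)%N ->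
  \sum_(k < N w) F k w = \sum_(k < n) ltN N k w * F k w.
Proof.
move=> Nn; rewrite (big_ord_widen n (fun k => F k w)) // big_mkcond /=.
by apply: eq_bigr => k _; rewrite /ltN; case: ifP => _; rewrite ?mul1r ?mul0r.
Qed.

Lemma measurable_random_sum N F : measurable_count N ->
  (forall k, measurable_fun setT (F k)) ->
  measurable_fun setT (fun w => \sum_(k < N w) F k w).
Proof.
move=> mN mF.
apply: (@measurable_fun_cvg _ _ _ _ (fun n w => \sum_(k < n) ltN N k w * F k w)).
  move=> n; apply: measurable_sum => k; apply: measurable_funM => //.
  exact: measurable_ltN.
move=> w _; apply: cvg_near_cst; exists (N w) => // n /= Nn.
by rewrite (random_sum_ltN F Nn).
Qed.

Lemma random_sum_nneseries N F w : (forall k, 0 <= F k w) ->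
  (\sum_(k < N w) F k w)%:E = (\sum_(0 <= k <oo) (ltN N k w * F k w)%:E)%E.
Proof.
move=> F0; apply/esym/cvg_lim => //.
apply: cvg_near_cst; exists (N w) => // n /= Nn.
by rewrite (random_sum_ltN F Nn) big_mkord sumEFin.
Qed.

Lemma integral_random_sum (mu : {measure set Om -> \bar R}) N F : measurable_count N ->
  (forall k, measurable_fun setT (F k)) -> (forall k w, 0 <= F k w) ->
  (\int[mu]_w (\sum_(k < N w) F k w)%:E =
   \sum_(0 <= k <oo) \int[mu]_w (ltN N k w * F k w)%:E)%E.
Proof.
move=> mN mF F0; under eq_integral do rewrite random_sum_nneseries //.
rewrite integral_nneseries // => k.
  by apply/measurable_EFinP/measurable_funM => //; exact: measurable_ltN.
by move=> w _; rewrite lee_fin mulr_ge0 ?ltN_ge0.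
Qed.

(** Comparison term by term; iterating it compares double sums over [k, j < N]. *)
Lemma le_integral_random_sum (mu : {measure set Om -> \bar R}) N F (f : nat -> Om -> R) (C : R) :
  measurable_count N -> 0 <= C ->
  (forall k, measurable_fun setT (F k)) -> (forall k w, 0 <= F k w) ->
  (forall k, measurable_fun setT (f k)) -> (forall k w, 0 <= f k w) ->
  (forall k, (\int[mu]_w (ltN N k w * F k w)%:E <=
     C%:E * \int[mu]_w (ltN N k w * f k w)%:E)%E) ->
  (\int[mu]_w (\sum_(k < N w) F k w)%:E <=
   C%:E * \int[mu]_w (\sum_(k < N w) f k w)%:E)%E.
Proof.
move=> mN C0 mF F0 mf f0 Ff; rewrite !integral_random_sum //.
rewrite -nneseriesZl; last first.
  by move=> k _; apply: integral_ge0 => w _; rewrite lee_fin mulr_ge0 ?ltN_ge0.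
apply: lee_nneseries => [k _ _|k _]; last exact: Ff.
by apply: integral_ge0 => w _; rewrite lee_fin mulr_ge0 ?ltN_ge0.
Qed.

End random_sums.

(** * Weighted sums of independent copies *)

Section measurability.
Context d (Om : measurableType d) (R : realType).
Implicit Types (f g : Om -> R).

Lemma measurable_fun_powR f p : measurable_fun setT f ->
  measurable_fun setT (fun w => f w `^ p).
Proof. by move=> mf; apply: (measurableT_comp (measurable_powR p)). Qed.

Lemma measurable_fun_normr f : measurable_fun setT f ->
  measurable_fun setT (fun w => `|f w|).
Proof. by move=> mf; apply: measurableT_comp. Qed.

Lemma measurable_pow_sum N (T : nat -> Om -> R) p : measurable_count N ->
  (forall k, measurable_fun setT (T k)) ->
  measurable_fun setT (fun w => pow_sum (N w) (fun k => `|T k w|) p).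
Proof.
move=> mN mT; apply: (@measurable_random_sum _ _ _ N (fun k w => `|T k w| `^ p)) => //.
by move=> k; apply: measurable_fun_powR; exact: measurable_fun_normr.
Qed.

Lemma measurable_offdiag N (T : nat -> Om -> R) p s : measurable_count N ->
  (forall k, measurable_fun setT (T k)) ->
  measurable_fun setT (fun w => offdiag (N w) (fun k => `|T k w|) p s).
Proof.
move=> mN mT.
pose F j w := `|T j w| `^ p *
  (\sum_(k < N w) (k != j :> nat)%:R * `|T k w|) `^ (s - p).
rewrite (_ : (fun w => _) = (fun w => \sum_(j < N w) F j w)).
  apply: measurable_random_sum => // j; apply: measurable_funM.
    by apply: measurable_fun_powR; exact: measurable_fun_normr.
  apply: measurable_fun_powR.
  apply: (@measurable_random_sum _ _ _ N (fun k w => (k != j :> nat)%:R * `|T k w|)) => // k.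
  by apply: measurable_funM => //; exact: measurable_fun_normr.
apply/funext => w; apply: eq_bigr => j _; congr (_ * _ `^ _).
by rewrite big_mkcond; apply: eq_bigr => k _; case: ifP => //= h;
  rewrite /= -val_eqE /= in h *; rewrite ?h ?mul1r ?mul0r.
Qed.

End measurability.

Lemma powR_young (R : realType) (x y s : R) : 0 <= x -> 0 <= y -> 1 < s ->
  x * y `^ (s - 1) <= x `^ s + y `^ s.
Proof.
move=> x0 y0 s1; have s0 : 0 < s by lra.
have s10 : 0 <= s - 1 by lra.
have [xy|/ltW yx] := leP x y.
  rewrite (@le_trans _ _ (y `^ s)) ?lerDr ?powR_ge0 // -(mulr_powRB1 y0 s0).
  by rewrite ler_wpM2r ?powR_ge0.
rewrite (@le_trans _ _ (x `^ s)) ?lerDl ?powR_ge0 // -(mulr_powRB1 x0 s0).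
by rewrite ler_wpM2l // ge0_ler_powR ?nnegrE.
Qed.

Lemma expectE d (Om : measurableType d) (R : realType) (P : probability Om R) (f : Om -> R) :
  ('E_P[f] = \int[P]_w (f w)%:E)%E.
Proof. by rewrite unlock. Qed.

Section model.
Context d (Om : measurableType d) (R : realType) (P : probability Om R).
Context (GT GX : set (set Om)) (N : Om -> nat) (T X : nat -> Om -> R) (Q X0 : Om -> R).
Notation OmT := (g_sigma_algebraType GT).
Notation OmX := (g_sigma_algebraType GX).
Notation Ex f := ('E_P[f])%E.

(** The assumptions on the fixed point equation that the moment estimates rest
    on, for plain functions: [GT] and [GX] generate independent sigma-algebras,
    the first one carrying [N], the weights and [Q], the second one carrying the
    copies [X k], which are distributed as [X0] and pairwise independent. *)
Definition weighted_model := [/\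
  [/\ GT `<=` measurable, GX `<=` measurable &
      forall A B, <<s GT >> A -> <<s GX >> B -> P (A `&` B) = (P A * P B)%E],
  [/\ @measurable_count _ OmT N, forall k, measurable_fun setT (T k : OmT -> R) &
      measurable_fun setT (Q : OmT -> R)],
  [/\ forall k, measurable_fun setT (X k : OmX -> R),
      measurable_fun setT X0 & forall k, eq_in_law P (X k) X0] &
  forall j k A B, j <> k -> measurable A -> measurable B ->
    P (X j @^-1` A `&` X k @^-1` B) = (P (X j @^-1` A) * P (X k @^-1` B))%E].

Hypothesis H : weighted_model.

Let GTm : GT `<=` measurable. Proof. by case: H => -[]. Qed.
Let GXm : GX `<=` measurable. Proof. by case: H => -[]. Qed.

Lemma measurable_number_wrt : @measurable_count _ OmT N.
Proof. by case: H => _ []. Qed.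

Lemma measurable_number : measurable_count N.
Proof.
move=> k; have := measurable_number_wrt k; apply: smallest_sub => //;
  exact: sigma_algebra_measurable.
Qed.

Lemma measurable_weight_wrt k : measurable_fun setT (T k : OmT -> R).
Proof. by case: H => _ []. Qed.
Lemma measurable_offset_wrt : measurable_fun setT (Q : OmT -> R).
Proof. by case: H => _ []. Qed.
Lemma measurable_copy_wrt k : measurable_fun setT (X k : OmX -> R).
Proof. by case: H => _ _ []. Qed.
Lemma measurable_weight k : measurable_fun setT (T k).
Proof. exact: measurable_wrt GTm (measurable_weight_wrt k). Qed.
Lemma measurable_offset : measurable_fun setT Q.
Proof. exact: measurable_wrt GTm measurable_offset_wrt. Qed.
Lemma measurable_copy k : measurable_fun setT (X k).
Proof. exact: measurable_wrt GXm (measurable_copy_wrt k). Qed.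
Lemma measurable_solution : measurable_fun setT X0.
Proof. by case: H => _ _ []. Qed.

Lemma integralM_TX (f g : Om -> R) :
  measurable_fun setT (f : OmT -> R) -> measurable_fun setT (g : OmX -> R) ->
  (forall w, 0 <= f w) -> (forall w, 0 <= g w) ->
  (Ex (fun w => (f w * g w)%R) = Ex f * Ex g)%E.
Proof.
move=> mf mg f0 g0; rewrite !expectE; apply: integralM_indep => //.
- exact: measurable_wrt GTm mf.
- exact: measurable_wrt GXm mg.
move=> A B mA mB; case: H => -[_ _ ind] _ _ _; apply: ind.
  exact: measurable_wrt_preimage.
exact: measurable_wrt_preimage.
Qed.

Lemma integral_X k (f : R -> R) : measurable_fun setT f -> (forall x, 0 <= f x) ->
  (Ex (fun w => f (X k w)) = Ex (fun w => f (X0 w)))%E.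
Proof.
move=> mf f0; rewrite !expectE; apply: integral_eq_in_law => //;
  [exact: measurable_copy|exact: measurable_solution|].
by case: H => _ _ [].
Qed.

Lemma integral_XX j k (f g : R -> R) : j <> k ->
  measurable_fun setT f -> (forall x, 0 <= f x) ->
  measurable_fun setT g -> (forall x, 0 <= g x) ->
  (Ex (fun w => (f (X j w) * g (X k w))%R) =
   Ex (fun w => f (X0 w)) * Ex (fun w => g (X0 w)))%E.
Proof.
move=> jk mf f0 mg g0.
rewrite -(integral_X j mf f0) -(integral_X k mg g0) !expectE.
apply: integralM_indep => //.
- by apply: measurableT_comp => //; exact: measurable_copy.
- by apply: measurableT_comp => //; exact: measurable_copy.
move=> A B mA mB; case: H => _ _ _ ind.
have := ind j k (f @^-1` A) (g @^-1` B) jk; apply.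
  by rewrite -(setTI (_ @^-1` _)); exact: mf.
by rewrite -(setTI (_ @^-1` _)); exact: mg.
Qed.

(** Wald's identity: the length and the coefficients of the sum are independent
    of its terms. *)
Lemma wald1 (f : nat -> Om -> R) (phi : R -> R) (C : R) :
  (forall k, measurable_fun setT (f k : OmT -> R)) -> (forall k w, 0 <= f k w) ->
  measurable_fun setT phi -> (forall x, 0 <= phi x) ->
  Ex (fun w => phi (X0 w)) = C%:E ->
  (Ex (fun w => (\sum_(k < N w) f k w * phi (X k w))%R) =
   C%:E * Ex (fun w => (\sum_(k < N w) f k w)%R))%E.
Proof.
move=> mf f0 mphi phi0 EC.
have mfk k : measurable_fun setT (f k) by exact: measurable_wrt GTm (mf k).
have mpX k : measurable_fun setT (fun w => phi (X k w)).
  by apply: measurableT_comp => //; exact: measurable_copy.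
have mNN := measurable_number.
rewrite !expectE (@integral_random_sum _ _ _ P N (fun k w => f k w * phi (X k w))) //; last 2 first.
- by move=> k; apply: measurable_funM.
- by move=> k w; rewrite mulr_ge0.
rewrite (@integral_random_sum _ _ _ P N f) // -nneseriesZl; last first.
  by move=> k _; apply: integral_ge0 => w _; rewrite lee_fin mulr_ge0 ?ltN_ge0.
apply: eq_eseriesr => k _.
under eq_integral do rewrite mulrA.
have := @integralM_TX (fun w => ltN R N k w * f k w) (fun w => phi (X k w)).
rewrite !expectE => ->.
- by rewrite -[X in (_ * X)%E]expectE integral_X // EC muleC.
- by apply: measurable_funM => //; exact: measurable_ltN measurable_number_wrt.
- by apply: measurableT_comp => //; exact: measurable_copy_wrt.
- by move=> w; rewrite mulr_ge0 ?ltN_ge0.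
- by [].
Qed.

(** For two distinct indices the three factors are independent: [phi (X j)] and
    [psi (X k)] by pairwise independence, and both from the coefficient. Only an
    inequality, since the diagonal is restored on the right. *)
Lemma wald2 (f : nat -> nat -> Om -> R) (phi psi : R -> R) (C D : R) :
  (forall j k, measurable_fun setT (f j k : OmT -> R)) -> (forall j k w, 0 <= f j k w) ->
  measurable_fun setT phi -> (forall x, 0 <= phi x) ->
  measurable_fun setT psi -> (forall x, 0 <= psi x) ->
  Ex (fun w => phi (X0 w)) = C%:E -> Ex (fun w => psi (X0 w)) = D%:E ->
  (Ex (fun w => (\sum_(j < N w) phi (X j w) *
                  \sum_(k < N w | k != j) f j k w * psi (X k w))%R) <=
   (C * D)%:E * Ex (fun w => (\sum_(j < N w) \sum_(k < N w) f j k w)%R))%E.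
Proof.
move=> mf f0 mphi phi0 mpsi psi0 EC ED.
have C0 : 0 <= C by rewrite -lee_fin -EC expectE; apply: integral_ge0 => w _; rewrite lee_fin.
have D0 : 0 <= D by rewrite -lee_fin -ED expectE; apply: integral_ge0 => w _; rewrite lee_fin.
have CD0 : 0 <= C * D by rewrite mulr_ge0.
have mfk j k : measurable_fun setT (f j k) by exact: measurable_wrt GTm (mf j k).
have mpX k : measurable_fun setT (fun w => phi (X k w)).
  by apply: measurableT_comp => //; exact: measurable_copy.
have mqX k : measurable_fun setT (fun w => psi (X k w)).
  by apply: measurableT_comp => //; exact: measurable_copy.
pose F j k w := (k != j :> nat)%:R * (phi (X j w) * (f j k w * psi (X k w))).
have mF j k : measurable_fun setT (F j k) by do ! apply: measurable_funM => //.
have F0 j k w : 0 <= F j k w by rewrite !mulr_ge0.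
have mNN := measurable_number.
have mlt k : measurable_fun setT (ltN R N k) by exact: measurable_ltN.
have mlt_T k : measurable_fun setT (ltN R N k : OmT -> R)
  by exact: measurable_ltN measurable_number_wrt.
rewrite !expectE (_ : (fun w => _) = fun w => (\sum_(j < N w) \sum_(k < N w) F j k w)%:E);
  last first.
  apply/funext => w; congr EFin; apply: eq_bigr => j _.
  rewrite big_mkcond mulr_sumr; apply: eq_bigr => k _.
  by rewrite /F -val_eqE /=; case: ifP => _; rewrite ?mul1r ?mul0r ?mulr0.
apply: (@le_integral_random_sum _ _ _ P N (fun j w => \sum_(k < N w) F j k w)
  (fun j w => \sum_(k < N w) f j k w)) => //.
- by move=> j; exact: measurable_random_sum.
- by move=> j w; exact: sumr_ge0.
- by move=> j; exact: measurable_random_sum.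
- by move=> j w; exact: sumr_ge0.
move=> j.
under eq_integral do rewrite mulr_sumr.
under [X in (_ <= _ * X)%E]eq_integral do rewrite mulr_sumr.
apply: (@le_integral_random_sum _ _ _ P N (fun k w => ltN R N j w * F j k w)
  (fun k w => ltN R N j w * f j k w)) => //.
- by move=> k; exact: measurable_funM.
- by move=> k w; rewrite mulr_ge0 ?ltN_ge0.
- by move=> k; exact: measurable_funM.
- by move=> k w; rewrite mulr_ge0 ?ltN_ge0.
move=> k; have [kj|kj] := eqVneq k j.
  rewrite (_ : (fun w => _) = cst 0%E); last first.
    by apply/funext => w; rewrite /F kj eqxx mul0r !mulr0.
  rewrite integral0 mule_ge0 ?lee_fin // integral_ge0 // => w _.
  by rewrite lee_fin !mulr_ge0 ?ltN_ge0.
rewrite (_ : (fun w => _) = fun w => ((ltN R N k w * (ltN R N j w * f j k w)) *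
   (phi (X j w) * psi (X k w)))%:E); last first.
  by apply/funext => w; rewrite /F kj; congr EFin; rewrite /=; ring.
have := @integralM_TX (fun w => ltN R N k w * (ltN R N j w * f j k w))
  (fun w => phi (X j w) * psi (X k w)).
rewrite !expectE => ->.
- rewrite -[X in (_ * X <= _)%E]expectE integral_XX //; last by apply/eqP; rewrite eq_sym.
  by rewrite EC ED -EFinM muleC.
- by do ! apply: measurable_funM => //.
- by apply: measurable_funM; apply: measurableT_comp => //; exact: measurable_copy_wrt.
- by move=> w; rewrite !mulr_ge0 ?ltN_ge0.
- by move=> w; rewrite mulr_ge0.
Qed.

End model.

(** * Integrability of the remainder *)

Section finite_expectation.
Context d (Om : measurableType d) (R : realType) (P : probability Om R).
Implicit Types f g : Om -> R.
Notation Ex f := ('E_P[f])%E.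

Lemma Ex_ge0 f : (forall w, 0 <= f w) -> (0 <= Ex f)%E.
Proof. by move=> f0; rewrite expectE; apply: integral_ge0 => w _; rewrite lee_fin. Qed.

Lemma Ex_le f g : measurable_fun setT f -> measurable_fun setT g ->
  (forall w, 0 <= f w) -> (forall w, f w <= g w) -> (Ex f <= Ex g)%E.
Proof.
move=> mf mg f0 fg; rewrite !expectE; apply: ge0_le_integral => //.
- by move=> w _; rewrite lee_fin.
- exact/measurable_EFinP.
- exact/measurable_EFinP.
- by move=> w _; rewrite lee_fin.
Qed.

Lemma ExD f g : measurable_fun setT f -> measurable_fun setT g ->
  (forall w, 0 <= f w) -> (forall w, 0 <= g w) ->
  (Ex (fun w => (f w + g w)%R) = Ex f + Ex g)%E.
Proof.
move=> mf mg f0 g0; rewrite !expectE; under eq_integral do rewrite EFinD.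
rewrite ge0_integralD //; try exact/measurable_EFinP.
- by move=> w _; rewrite lee_fin.
- by move=> w _; rewrite lee_fin.
Qed.

Lemma ExZ (c : R) f : measurable_fun setT f -> 0 <= c -> (forall w, 0 <= f w) ->
  (Ex (fun w => (c * f w)%R) = c%:E * Ex f)%E.
Proof.
move=> mf c0 f0; rewrite !expectE; under eq_integral do rewrite EFinM.
rewrite ge0_integralZl_EFin //; last exact/measurable_EFinP.
by move=> w _; rewrite lee_fin.
Qed.

Lemma Ex_cst (c : R) : Ex (fun=> c) = c%:E.
Proof. exact: expectation_cst. Qed.

Lemma eq_Ex f g : f =1 g -> Ex f = Ex g.
Proof. by move=> fg; congr expectation; exact/funext. Qed.

Lemma Ex_EFin f : (forall w, 0 <= f w) -> (Ex f < +oo)%E ->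
  exists c, 0 <= c /\ Ex f = c%:E.
Proof.
move=> f0 fi; have e0 := Ex_ge0 f0.
exists (fine (Ex f)); split; first exact: fine_ge0.
by rewrite fineK // ge0_fin_numE.
Qed.

Lemma Ex_lty_le f g : measurable_fun setT f -> measurable_fun setT g ->
  (forall w, 0 <= f w) -> (forall w, f w <= g w) -> (Ex g < +oo)%E -> (Ex f < +oo)%E.
Proof. by move=> mf mg f0 fg; apply: le_lt_trans; exact: Ex_le. Qed.

Lemma Ex_lty_add f g : measurable_fun setT f -> measurable_fun setT g ->
  (forall w, 0 <= f w) -> (forall w, 0 <= g w) -> (Ex f < +oo)%E -> (Ex g < +oo)%E ->
  (Ex (fun w => (f w + g w)%R) < +oo)%E.
Proof. by move=> mf mg f0 g0 fi gi; rewrite ExD // lte_add_pinfty. Qed.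

Lemma Ex_lty_scale (c : R) f : measurable_fun setT f -> 0 <= c ->
  (forall w, 0 <= f w) -> (Ex f < +oo)%E -> (Ex (fun w => (c * f w)%R) < +oo)%E.
Proof.
move=> mf c0 f0 fi; rewrite ExZ //; have [x [x0 ->]] := Ex_EFin f0 fi.
by rewrite -EFinM ltry.
Qed.

Lemma Ex_powR_lty_le f a b : measurable_fun setT f -> (forall w, 0 <= f w) ->
  0 <= a -> a <= b -> (Ex (fun w => (f w `^ b)%R) < +oo)%E ->
  (Ex (fun w => (f w `^ a)%R) < +oo)%E.
Proof.
move=> mf f0 a0 ab fb.
apply: (@Ex_lty_le _ (fun w => 1 + f w `^ b)) => //.
- exact: measurable_fun_powR.
- by apply: measurable_funD => //; exact: measurable_fun_powR.
- by move=> w; exact: powR_ge0.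
- by move=> w; rewrite -(powRr0 (f w)) powR_le_sum.
apply: (@Ex_lty_add (fun=> 1)) => //.
- exact: measurable_fun_powR.
- by move=> w; exact: powR_ge0.
by rewrite Ex_cst ltry.
Qed.

End finite_expectation.

Section moment_bound.
Context d (Om : measurableType d) (R : realType) (P : probability Om R).
Context (GT GX : set (set Om)) (N : Om -> nat) (T X : nat -> Om -> R) (Q X0 : Om -> R).
Notation OmT := (g_sigma_algebraType GT).
Notation OmX := (g_sigma_algebraType GX).
Notation Ex f := ('E_P[f])%E.
Hypothesis H : weighted_model P GT GX N T X Q X0.

Let W p w : R := pow_sum (N w) (fun k => `|T k w|) p.

(** The error term of [max_term_split] for the sum [\sum_(k < N) T k * X k + Q]. *)
Definition remainder p s w : R :=
  `|Q w| `^ s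
  + (if 1 < s then `|Q w| * (\sum_(k < N w) `|T k w * X k w|) `^ (s - 1) else 0)
  + offdiag (N w) (fun k => `|T k w * X k w|) p s.

(** Under these conditions the remainder of order [s] is integrable, although
    the moment of [X0] of order [s] need not be finite. *)
Definition good_exponents p s := [/\ 0 < p, p <= 1, p <= s,
  (Ex (fun w => (`|X0 w| `^ p)%R) < +oo)%E /\
  (Ex (fun w => (`|X0 w| `^ (s - p))%R) < +oo)%E &
  (Ex (fun w => (pow_sum (N w) (fun k => `|T k w|) p `^ (s / p))%R) < +oo)%E /\
  (Ex (fun w => (`|Q w| `^ s)%R) < +oo)%E].

Lemma good_exponents_le p s s' : p <= s' -> s' <= s -> good_exponents p s ->
  good_exponents p s'.
Proof.
move=> ps' s's [p0 p1 ps [Ep Es] [EW EQ]]; split=> //.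
  split => //; apply: (Ex_powR_lty_le _ _ _ _ Es) => //; rewrite ?subr_ge0 ?lerD2r //.
  exact/measurable_fun_normr/(measurable_solution H).
split.
  apply: (Ex_powR_lty_le _ _ _ _ EW).
  - exact: measurable_pow_sum (measurable_number H) (measurable_weight H).
  - by move=> w; apply: sumr_ge0 => k _; exact: powR_ge0.
  - by rewrite divr_ge0 //; lra.
  - by rewrite ler_pM2r ?invr_gt0.
apply: (Ex_powR_lty_le _ _ _ _ EQ) => //; last lra.
exact/measurable_fun_normr/(measurable_offset H).
Qed.

Let W_ge0 p w : 0 <= W p w. Proof. exact: pow_sum_ge0. Qed.

Let mW_T p : measurable_fun setT (W p : OmT -> R).
Proof.
exact: (@measurable_pow_sum _ OmT R N T p (measurable_number_wrt H) (measurable_weight_wrt H)).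
Qed.

Let mW p : measurable_fun setT (W p).
Proof. exact: measurable_pow_sum (measurable_number H) (measurable_weight H). Qed.

Lemma measurable_term k : measurable_fun setT (fun w => T k w * X k w).
Proof. apply: measurable_funM; [exact: (measurable_weight H)|exact: (measurable_copy H)]. Qed.

Lemma remainder_ge0 p s w : 0 <= remainder p s w.
Proof.
rewrite !addr_ge0 ?powR_ge0 //.
  by case: ifP => // _; rewrite mulr_ge0 ?powR_ge0.
by apply: sumr_ge0 => j _; rewrite mulr_ge0 ?powR_ge0.
Qed.

Lemma measurable_sum_norm_term : measurable_fun setT (fun w => \sum_(k < N w) `|T k w * X k w|).
Proof.
apply: (@measurable_random_sum _ _ _ N (fun k w => `|T k w * X k w|));
  first exact: (measurable_number H).
by move=> k; exact/measurable_fun_normr/measurable_term.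
Qed.

Lemma measurable_remainder p s : measurable_fun setT (remainder p s).
Proof.
apply: measurable_funD; [apply: measurable_funD|].
- exact/measurable_fun_powR/measurable_fun_normr/(measurable_offset H).
- have [s1|s1] := ltP 1 s => //; apply: measurable_funM.
    exact/measurable_fun_normr/(measurable_offset H).
  exact/measurable_fun_powR/measurable_sum_norm_term.
- exact:
    (@measurable_offdiag _ _ _ N (fun k w => T k w * X k w) p s (measurable_number H) measurable_term).
Qed.

Let mPhi p q : measurable_fun setT (fun x : R => `|x| `^ p + `|x| `^ q).
Proof. by apply: measurable_funD; apply: measurable_fun_powR; exact: measurable_fun_normr. Qed.

(** Split each term with [powR_wsum_le] and average over the copies with
    [wald1] and [wald2]: in both resulting sums the weights add up to
    [W p `^ (s / p)]. *)
Lemma offdiag_lty p s : good_exponents p s ->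
  (Ex (fun w => offdiag (N w) (fun k => `|(T k w * X k w)%R|%R) p s) < +oo)%E.
Proof.
move=> G; have [p0 p1 ps [Ep Es] [EW _]] := G.
pose q := s - p; pose r := q / p.
have q0 : 0 <= q by rewrite subr_ge0.
have r0 : 0 <= r by rewrite divr_ge0 // ltW.
have r1 : r + 1 = s / p by rewrite /r /q mulrBl divff ?subrK ?gt_eqF.
have mX0' := measurable_solution H.
have mabs a : measurable_fun setT (fun w => `|X0 w| `^ a).
  exact/measurable_fun_powR/measurable_fun_normr.
have [C [C0 EC]] : exists C, 0 <= C /\ Ex (fun w => (`|X0 w| `^ p)%R) = C%:E.
  by apply: Ex_EFin => // w; exact: powR_ge0.
have [D [D0 ED]] : exists D, 0 <= D /\ Ex (fun w => (`|X0 w| `^ p + `|X0 w| `^ q)%R) = D%:E.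
  apply: Ex_EFin; first by move=> w; rewrite addr_ge0 ?powR_ge0.
  by apply: Ex_lty_add => // w; exact: powR_ge0.
pose f1 k w := `|T k w| `^ p * W p w `^ r.
pose f2 j k w := `|T j w| `^ p * `|T k w| `^ p * W p w `^ (r - 1).
have mA_T k : measurable_fun setT ((fun w => `|T k w| `^ p) : OmT -> R).
  apply: (@measurable_fun_powR _ OmT); apply: (@measurable_fun_normr _ OmT);
    exact: (measurable_weight_wrt H).
have mf1 k : measurable_fun setT (f1 k : OmT -> R).
  by apply: (@measurable_funM _ OmT) => //; apply: (@measurable_fun_powR _ OmT); exact: mW_T.
have mf2 j k : measurable_fun setT (f2 j k : OmT -> R).
  apply: (@measurable_funM _ OmT); first exact: (@measurable_funM _ OmT).
  by apply: (@measurable_fun_powR _ OmT); exact: mW_T.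
have f10 k w : 0 <= f1 k w by rewrite mulr_ge0 ?powR_ge0.
have f20 j k w : 0 <= f2 j k w by rewrite !mulr_ge0 ?powR_ge0.
have GTm : GT `<=` measurable by case: H => -[].
have mf1' k : measurable_fun setT (f1 k) by exact: measurable_wrt GTm (mf1 k).
have mf2' j k : measurable_fun setT (f2 j k) by exact: measurable_wrt GTm (mf2 j k).
have mphi : measurable_fun setT (fun x : R => `|x| `^ p).
  by apply: measurable_fun_powR; exact: measurable_fun_normr.
have phi0 (x : R) : 0 <= `|x| `^ p by exact: powR_ge0.
have psi0 (x : R) : 0 <= `|x| `^ p + `|x| `^ q by rewrite addr_ge0 ?powR_ge0.
have w1 := wald1 H mf1 f10 mphi phi0 EC.
have w2 := wald2 H mf2 f20 mphi phi0 (mPhi p q) psi0 EC ED.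
pose S1 w := \sum_(k < N w) f1 k w * `|X k w| `^ p.
pose S2 w := \sum_(j < N w) `|X j w| `^ p *
   \sum_(k < N w | k != j) f2 j k w * (`|X k w| `^ p + `|X k w| `^ q).
have mNN := measurable_number H.
have mXp k a : measurable_fun setT (fun w => `|X k w| `^ a).
  by apply: measurable_fun_powR; apply: measurable_fun_normr; exact: (measurable_copy H).
have mS1 : measurable_fun setT S1.
  apply: (@measurable_random_sum _ _ _ N (fun k w => f1 k w * `|X k w| `^ p)) => // k.
  exact: measurable_funM.
have mS2 : measurable_fun setT S2.
  rewrite (_ : S2 = fun w => \sum_(j < N w) (`|X j w| `^ p * \sum_(k < N w)
     (k != j :> nat)%:R * (f2 j k w * (`|X k w| `^ p + `|X k w| `^ q)))); last first.
    apply/funext => w; apply: eq_bigr => j _; congr (_ * _).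
    rewrite big_mkcond; apply: eq_bigr => k _.
    by rewrite -val_eqE /=; case: ifP => _; rewrite ?mul1r ?mul0r.
  apply: (@measurable_random_sum _ _ _ N (fun j w => `|X j w| `^ p * \sum_(k < N w)
     (k != j :> nat)%:R * (f2 j k w * (`|X k w| `^ p + `|X k w| `^ q)))) => // j.
  apply: measurable_funM => //.
  apply: (@measurable_random_sum _ _ _ N (fun k w =>
     (k != j :> nat)%:R * (f2 j k w * (`|X k w| `^ p + `|X k w| `^ q)))) => // k.
  apply: measurable_funM => //; apply: measurable_funM => //; exact: measurable_funD.
have S10 w : 0 <= S1 w by apply: sumr_ge0 => k _; rewrite mulr_ge0.
have S20 w : 0 <= S2 w.
  by apply: sumr_ge0 => j _; rewrite mulr_ge0 // sumr_ge0 // => k _; rewrite mulr_ge0.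
have Wr w : W p w * W p w `^ r = W p w `^ (s / p).
  rewrite -r1 powRD; last by rewrite gt_eqF // ltr_wpDl.
  by rewrite powRr1 ?W_ge0 // mulrC.
apply: (@Ex_lty_le _ _ _ _ _ (fun w => S1 w + S2 w)).
- exact:
    (@measurable_offdiag _ _ _ N (fun k w => T k w * X k w) p s (measurable_number H) measurable_term).
- exact: measurable_funD.
- by move=> w; apply: sumr_ge0 => j _; rewrite mulr_ge0 ?powR_ge0.
- move=> w; rewrite /S1 /S2 -big_split /=; apply: ler_sum => j _.
  have TX k : `|T k w * X k w| = `|T k w| * `|X k w| by rewrite normrM.
  have -> : \sum_(k < N w | k != j) `|T k w * X k w| =
      \sum_(k < N w | k != j) `|T k w| * `|X k w| by apply: eq_bigr.
  have := @powR_wsum_le R (N w) (fun k => k != j) (fun k => `|T k w|)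
     (fun k => `|X k w|) p (s - p) (fun=> normr_ge0 _) (fun=> normr_ge0 _) p0 p1 q0.
  rewrite -/(W p w) -/q -/r => le1.
  rewrite TX powRM // -mulrA.
  rewrite (le_trans (ler_wpM2l (powR_ge0 _ _) (ler_wpM2l (powR_ge0 _ _) le1))) //.
  rewrite !mulrDr /f1 lerD //; first by rewrite mulrAC mulrA.
  rewrite le_eqVlt; apply/orP; left; apply/eqP.
  rewrite !mulr_sumr; apply: eq_bigr => k _; rewrite /f2; ring.
apply: Ex_lty_add => //.
- rewrite /S1 w1.
  rewrite (@eq_Ex _ _ _ P _ (fun w => W p w `^ (s / p))); last first.
    by move=> w; rewrite /f1 -mulr_suml -Wr.
  have [c [_ ->]] := Ex_EFin (fun w => powR_ge0 _ _) EW.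
  by rewrite -EFinM ltry.
- rewrite /S2 (le_lt_trans w2) //.
  rewrite (@eq_Ex _ _ _ P _ (fun w => W p w `^ (s / p))); last first.
    move=> w; rewrite /f2.
    rewrite (eq_bigr (fun j : 'I_(N w) => `|T j w| `^ p * (W p w * W p w `^ (r - 1)))).
      rewrite -mulr_suml -[\sum_(i < _) _]/(W p w).
      have [->|Wn0] := eqVneq (W p w) 0.
        by rewrite mul0r powR0 // gt_eqF // divr_gt0 //; lra.
      rewrite -r1 -[X in X * (X * _)]powRr1 ?W_ge0 // -!powRD ?Wn0 ?implybT //.
      by congr (_ `^ _); ring.
    move=> j _; rewrite -mulr_suml -mulr_sumr -mulrA; congr (_ * _).
  have [c [_ ->]] := Ex_EFin (fun w => powR_ge0 _ _) EW.
  by rewrite -EFinM ltry.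
Qed.

(** Again by [powR_wsum_le] and [wald1]. The weights now come with the factor
    [|Q|], and [|Q| * W p `^ ((s - 1) / p)] is split by Young's inequality with
    the exponents [s] and [s / (s - 1)]. *)
Lemma cross_lty p s : good_exponents p s -> 1 < s ->
  (Ex (fun w => (`|Q w| * (\sum_(k < N w) `|T k w * X k w|) `^ (s - 1))%R) < +oo)%E.
Proof.
move=> G s1; have [p0 p1 ps [Ep Es] [EW EQ]] := G.
pose q := s - 1; pose r := q / p.
have q0 : 0 < q by rewrite subr_gt0.
have r0 : 0 < r by rewrite divr_gt0.
have mX0' := measurable_solution H.
have mabs a : measurable_fun setT (fun w => `|X0 w| `^ a).
  exact/measurable_fun_powR/measurable_fun_normr.
have [D [D0 ED]] : exists D, 0 <= D /\ Ex (fun w => (`|X0 w| `^ p + `|X0 w| `^ q)%R) = D%:E.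
  apply: Ex_EFin; first by move=> w; rewrite addr_ge0 ?powR_ge0.
  apply: Ex_lty_add => //; try by move=> w; exact: powR_ge0.
  apply: (Ex_powR_lty_le _ _ _ _ Es) => //; first exact: measurable_fun_normr.
    exact: ltW.
  by rewrite /q; lra.
pose f0 w := `|Q w| * W p w `^ r.
pose f1 k w := `|Q w| * W p w `^ (r - 1) * `|T k w| `^ p.
have mA_T k : measurable_fun setT ((fun w => `|T k w| `^ p) : OmT -> R).
  apply: (@measurable_fun_powR _ OmT); apply: (@measurable_fun_normr _ OmT);
    exact: (measurable_weight_wrt H).
have mQT' : measurable_fun setT ((fun w => `|Q w|) : OmT -> R).
  apply: (@measurable_fun_normr _ OmT); exact: (measurable_offset_wrt H).
have mf1 k : measurable_fun setT (f1 k : OmT -> R).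
  apply: (@measurable_funM _ OmT) => //; apply: (@measurable_funM _ OmT) => //.
  by apply: (@measurable_fun_powR _ OmT); exact: mW_T.
have f10 k w : 0 <= f1 k w by rewrite !mulr_ge0 ?powR_ge0.
have GTm : GT `<=` measurable by case: H => -[].
have mf1' k : measurable_fun setT (f1 k) by exact: measurable_wrt GTm (mf1 k).
have mQ' := measurable_offset H; have mWp := mW p.
have mf0 : measurable_fun setT f0.
  by apply: measurable_funM; [exact: measurable_fun_normr|exact: measurable_fun_powR].
have f00 w : 0 <= f0 w by rewrite mulr_ge0 ?powR_ge0.
have psi0 (x : R) : 0 <= `|x| `^ p + `|x| `^ q by rewrite addr_ge0 ?powR_ge0.
have w1 := wald1 H mf1 f10 (mPhi p q) psi0 ED.
pose S1 w := \sum_(k < N w) f1 k w * (`|X k w| `^ p + `|X k w| `^ q).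
have mXp k a : measurable_fun setT (fun w => `|X k w| `^ a).
  by apply: measurable_fun_powR; apply: measurable_fun_normr; exact: (measurable_copy H).
have mS1 : measurable_fun setT S1.
  apply: (@measurable_random_sum _ _ _ N
     (fun k w => f1 k w * (`|X k w| `^ p + `|X k w| `^ q))); first exact: (measurable_number H).
  by move=> k; apply: measurable_funM => //; exact: measurable_funD.
have S10 w : 0 <= S1 w by apply: sumr_ge0 => k _; rewrite mulr_ge0.
have Ef0 : (Ex f0 < +oo)%E.
  apply: (@Ex_lty_le _ _ _ _ _ (fun w => `|Q w| `^ s + W p w `^ (s / p))) => //.
  - by apply: measurable_funD; apply: measurable_fun_powR => //; exact: measurable_fun_normr.
  - move=> w; rewrite /f0 (_ : W p w `^ r = (W p w `^ p^-1) `^ (s - 1)).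
      rewrite (le_trans (powR_young _ _ s1)) ?powR_ge0 // lerD2l.
      by rewrite -powRrM [_ * s]mulrC.
    by rewrite -powRrM /r /q mulrC.
  apply: Ex_lty_add => //.
  - by apply: measurable_fun_powR; exact: measurable_fun_normr.
  - exact: measurable_fun_powR.
  - by move=> w; exact: powR_ge0.
apply: (@Ex_lty_le _ _ _ _ _ (fun w => f0 w + S1 w)).
- apply: measurable_funM; first exact: measurable_fun_normr.
  exact/measurable_fun_powR/measurable_sum_norm_term.
- exact: measurable_funD.
- by move=> w; rewrite mulr_ge0 ?powR_ge0.
- move=> w; rewrite /f0 /S1.
  under eq_bigr do rewrite normrM.
  have := @powR_wsum_le R (N w) predT (fun k => `|T k w|)
     (fun k => `|X k w|) p (s - 1) (fun=> normr_ge0 _) (fun=> normr_ge0 _) p0 p1 (ltW q0).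
  rewrite -/(W p w) -/q -/r => le1.
  rewrite (le_trans (ler_wpM2l (normr_ge0 _) le1)) // mulrDr lerD2l.
  rewrite !mulr_sumr ler_sum // => k _; rewrite le_eqVlt; apply/orP; left.
  by apply/eqP; rewrite /f1; ring.
apply: Ex_lty_add => //.
rewrite /S1 w1 (@eq_Ex _ _ _ P _ f0); last first.
  move=> w; rewrite /f1 /f0 -mulr_sumr -mulrA; congr (_ * _).
  rewrite -[\sum_(i < _) _]/(W p w).
  have [->|Wn0] := eqVneq (W p w) 0; first by rewrite mulr0 powR0 // gt_eqF.
  by rewrite -[X in _ * X]powRr1 ?W_ge0 // -powRD ?Wn0 ?implybT // subrK.
have [c [_ ->]] := Ex_EFin f00 Ef0.
by rewrite -EFinM ltry.
Qed.

Lemma remainder_lty p s : good_exponents p s -> (Ex (remainder p s) < +oo)%E.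
Proof.
move=> G; have [p0 p1 ps [Ep Es] [EW EQ]] := G.
have mQs : measurable_fun setT (fun w => `|Q w| `^ s).
  exact/measurable_fun_powR/measurable_fun_normr/(measurable_offset H).
have moff :=
    @measurable_offdiag _ _ _ N (fun k w => T k w * X k w) p s (measurable_number H) measurable_term.
have off0 w : 0 <= offdiag (N w) (fun k => `|T k w * X k w|) p s.
  by apply: sumr_ge0 => j _; rewrite mulr_ge0 ?powR_ge0.
rewrite /remainder; have [s1|s1] := ltP 1 s; last first.
  rewrite (@eq_Ex _ _ _ P _ (fun w => `|Q w| `^ s + offdiag (N w) (fun k => `|T k w * X k w|) p s));
    last by move=> w; rewrite addr0.
  by apply: Ex_lty_add; rewrite ?offdiag_lty // => w; exact: powR_ge0.
have mc : measurable_fun setT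
    (fun w => `|Q w| * (\sum_(k < N w) `|T k w * X k w|) `^ (s - 1)).
  apply: measurable_funM; first exact/measurable_fun_normr/(measurable_offset H).
  exact/measurable_fun_powR/measurable_sum_norm_term.
apply: (@Ex_lty_add _ _ _ _ (fun w => `|Q w| `^ s +
  `|Q w| * (\sum_(k < N w) `|T k w * X k w|) `^ (s - 1))); rewrite ?offdiag_lty //.
- exact: measurable_funD.
- by move=> w; rewrite addr_ge0 ?mulr_ge0 ?powR_ge0.
apply: Ex_lty_add => //; last exact: cross_lty G s1.
- by move=> w; rewrite mulr_ge0 ?powR_ge0.
Qed.

End moment_bound.

(** * Gaining moments by tilting *)

Section monotone_limit.
Context d (Om : measurableType d) (R : realType) (P : probability Om R).
Notation Ex f := (expectation P f).

Lemma gain0 q e t : gain q e 0 t = t `^ (q + e) :> R.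
Proof. by rewrite /gain mul0r addr0 expr1n divr1. Qed.

Lemma gain_anti q e t eta eta' : 0 <= eta -> eta <= eta' ->
  gain q e eta' t <= gain q e eta t :> R.
Proof.
move=> eta0 ee; have eta'0 := le_trans eta0 ee.
rewrite /gain ler_wpM2l ?powR_ge0 // lef_pV2 ?posrE ?exprn_gt0 ?damp_gt0 //.
rewrite lerXn2r ?nnegrE ?(ltW (damp_gt0 _ _ _)) // lerD2l ler_wpM2r ?powR_ge0 //.
Qed.

Lemma cvg_gain q e t :
  gain q e (n.+1%:R^-1) t @[n --> \oo] --> (t `^ (q + e) : R).
Proof.
rewrite -[X in _ --> X](gain0 q e t) /gain; apply: cvgM; first exact: cvg_cst.
apply: cvgV; first by rewrite mul0r addr0 expr1n oner_neq0.
under eq_fun do rewrite expr2; rewrite expr2.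
have h : 1 + n.+1%:R^-1 * t `^ e @[n --> \oo] --> (1 + 0 * t `^ e : R).
  apply: cvgD; first exact: cvg_cst.
  by apply: cvgM; [exact: cvg_harmonic|exact: cvg_cst].
exact: cvgM.
Qed.

Lemma measurable_gain q e eta : 0 <= eta -> measurable_fun setT (gain q e eta : R -> R).
Proof.
move=> eta0.
rewrite (_ : gain q e eta = fun t => t `^ (q + e) * ((1 + eta * t `^ e) ^+ 2) `^ (-1)).
  apply: measurable_funM; first exact: measurable_powR.
  apply: measurable_fun_powR; apply: measurable_funX; apply: measurable_funD => //.
  by apply: measurable_funM => //; exact: measurable_powR.
by apply/funext => t; rewrite powR_inv1 // exprn_ge0 // ltW // damp_gt0.
Qed.

Lemma measurable_tilt q e eta : 0 <= eta -> measurable_fun setT (tilt q e eta : R -> R).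
Proof.
move=> eta0.
rewrite (_ : tilt q e eta = fun t => t `^ (q + e) * (1 + eta * t `^ e) `^ (-1)).
  apply: measurable_funM; first exact: measurable_powR.
  apply: measurable_fun_powR; apply: measurable_funD => //.
  by apply: measurable_funM => //; exact: measurable_powR.
by apply/funext => t; rewrite powR_inv1 // ltW // damp_gt0.
Qed.

Lemma measurable_defect q e eta : 0 <= eta -> measurable_fun setT (defect q e eta : R -> R).
Proof.
move=> eta0.
rewrite (_ : defect q e eta = fun t => t `^ q * (eta * (1 + eta * t `^ e)) `^ (-1)).
  apply: measurable_funM; first exact: measurable_powR.
  apply: measurable_fun_powR; apply: measurable_funM => //; apply: measurable_funD => //.
  by apply: measurable_funM => //; exact: measurable_powR.
by apply/funext => t; rewrite powR_inv1 // mulr_ge0 // ltW // damp_gt0.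
Qed.

(** The functions [gain] increase to the power as [eta] decreases to 0, so
    monotone convergence applies. *)
Lemma Ex_powR_le_gain (X : Om -> R) q e (C : R) : measurable_fun setT X ->
  (forall eta, 0 < eta -> (Ex (fun w => gain q e eta `|X w|) <= C%:E)%E) ->
  (Ex (fun w => (`|X w| `^ (q + e))%R) <= C%:E)%E.
Proof.
move=> mX hC.
pose g (n : nat) w : \bar R := (gain q e n.+1%:R^-1 `|X w|)%:E.
have mg n : measurable_fun setT (g n).
  apply/measurable_EFinP; apply: (measurableT_comp (f := gain q e n.+1%:R^-1)).
    by apply: measurable_gain; rewrite invr_ge0.
  exact: measurable_fun_normr.
have := @monotone_convergence _ _ _ P setT measurableT g mg.
have g0 n x : setT x -> (0 <= g n x)%E by rewrite lee_fin gain_ge0 // invr_ge0.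
have ndg x : setT x -> {homo g^~ x : n m / (n <= m)%N >-> (n <= m)%E}.
  move=> _ n m nm; rewrite lee_fin gain_anti ?invr_ge0 //.
  by rewrite lef_pV2 ?posrE ?ltr0n // ler_nat.
move=> /(_ g0 ndg) mc.
have e1 : (Ex (fun w => (`|X w| `^ (q + e))%R) = \int[P]_x limn (g^~ x))%E.
  rewrite expectE; apply: eq_integral => w _; apply/esym/cvg_lim => //.
  by apply: cvg_EFin; [exact: nearW|exact: cvg_gain].
rewrite e1 mc; apply: lime_le.
  apply: ereal_nondecreasing_is_cvgn => n m nm; apply: ge0_le_integral => //.
  - by move=> w _; exact: g0.
  - by move=> w _; exact: ndg.
apply: nearW => n; have := hC n.+1%:R^-1; rewrite expectE; apply.
by rewrite invr_gt0 ltr0n.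
Qed.

End monotone_limit.

Section tilting.
Context d (Om : measurableType d) (R : realType) (P : probability Om R).
Context (GT GX : set (set Om)) (N : Om -> nat) (T X : nat -> Om -> R) (Q X0 : Om -> R).
Notation Ex f := (expectation P f).
Hypothesis H : weighted_model P GT GX N T X Q X0.
Hypothesis HL : eq_in_law P X0 (fun w => \sum_(k < N w) T k w * X k w + Q w).

Let a k w : R := `|T k w * X k w|.
Let rho w : R := `|\sum_(k < N w) T k w * X k w + Q w|.

Lemma measurable_rho : measurable_fun setT rho.
Proof.
apply: measurable_fun_normr; apply: measurable_funD; last exact: (measurable_offset H).
apply: (@measurable_random_sum _ _ _ N (fun k w => T k w * X k w));
  first exact: (measurable_number H).
by move=> k; exact: (measurable_term H).
Qed.

Lemma measurable_sum_a (f : R -> R) : measurable_fun setT f ->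
  measurable_fun setT (fun w => \sum_(k < N w) f (a k w)).
Proof.
move=> mf; apply: (@measurable_random_sum _ _ _ N (fun k w => f (a k w)));
  first exact: (measurable_number H).
move=> k; apply: measurableT_comp => //; apply: measurable_fun_normr; exact: (measurable_term H).
Qed.

Lemma Ex_rho (f : R -> R) : measurable_fun setT f -> (forall x, 0 <= f x) ->
  Ex (fun w => f (rho w)) = Ex (fun w => f `|X0 w|).
Proof.
move=> mf f0; rewrite !expectE; apply/esym.
have mrho : measurable_fun setT (fun w => \sum_(k < N w) T k w * X k w + Q w).
  apply: measurable_funD; last exact: (measurable_offset H).
  apply: (@measurable_random_sum _ _ _ N (fun k w => T k w * X k w));
    first exact: (measurable_number H).
  by move=> k; exact: (measurable_term H).
apply: (@integral_eq_in_law _ _ _ P _ _ (fun x => f `|x|)) => //;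
  first exact: (measurable_solution H).
by apply: (measurableT_comp mf); exact: normr_measurable.
Qed.

Lemma wald_pow (q mq : R) (f : R -> R) (c : R) :
  Ex (fun w => pow_sum (N w) (fun k => `|T k w|) q) = mq%:E ->
  measurable_fun setT f -> (forall x, 0 <= f x) ->
  Ex (fun w => f `|X0 w|) = c%:E ->
  Ex (fun w => (\sum_(k < N w) `|T k w| `^ q * f `|X k w|)%R) = (mq * c)%:E.
Proof.
move=> Emq mf f0 Ec.
rewrite (wald1 H (f := fun k w => `|T k w| `^ q) (phi := fun x => f `|x|) (C := c)) //.
- by rewrite -/(pow_sum _ _ _) Emq -EFinM mulrC.
- move=> k; apply: (@measurable_fun_powR _ (g_sigma_algebraType GT)).
  apply: (@measurable_fun_normr _ (g_sigma_algebraType GT)); exact: (measurable_weight_wrt H).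
- by apply: (measurableT_comp mf); exact: normr_measurable.
Qed.

(** [max_term_split] with [f] the function [tilt]: it is dominated by the power
    [q + e], and so are its increments. *)
Lemma sum_tilt_le p q e eta w : 0 < q -> 0 < e -> 0 < eta -> 0 < p -> p <= 1 ->
  p <= q + e ->
  \sum_(k < N w) tilt q e eta (a k w) <=
  tilt q e eta (rho w) + max_const (q + e) * remainder N T X Q p (q + e) w.
Proof.
move=> q0 e0 eta0 p0 p1 ps.
have [M [J [M0 Jf Jb]]] :=
  @max_term_split R (N w) (fun k => T k w * X k w) (Q w) p (q + e) p0 p1 ps.
rewrite -/(rho w) in Jb.
have t0 : tilt q e eta 0 = 0 :> R by rewrite /tilt powR0 ?mul0r // gt_eqF // addr_gt0.
rewrite (Jf _ t0).
have h1 := tilt_sub_le q0 e0 eta0 M0 (normr_ge0 (\sum_(k < N w) T k w * X k w + Q w)).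
rewrite -/(rho w) distrC in h1.
have h2 : \sum_(k < N w | J k) tilt q e eta (a k w) <= \sum_(k < N w | J k) a k w `^ (q + e).
  by apply: ler_sum => k _; exact: tilt_le_powR (ltW eta0).
set D := `|_ - _| in h1 Jb.
set S1 := \sum_(k < N w | J k) tilt _ _ _ _ in h2 *.
set S2 := \sum_(k < N w | J k) _ in h2 Jb.
have {}Jb : S2 + D <= max_const (q + e) * remainder N T X Q p (q + e) w by exact: Jb.
by lra.
Qed.

Section delta.
Variables (p q : R).
Hypothesis G : good_exponents P N T Q X0 p q.

(** Its expectation is [beta] times the constant K(beta) when [q = beta]
    ([constantE]); it is integrable even if neither of its two terms is. *)
Definition moment_gap w : R := rho w `^ q - \sum_(k < N w) a k w `^ q.

Let q0 : 0 < q. Proof. by case: G => p0 _ pq _ _; exact: lt_le_trans pq. Qed.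

Lemma moment_gap_le w : `|moment_gap w| <= max_const q * remainder N T X Q p q w.
Proof.
have [p0 p1 pq _ _] := G.
have [M [J [M0 Jf Jb]]] :=
  @max_term_split R (N w) (fun k => T k w * X k w) (Q w) p q p0 p1 pq.
apply: le_trans Jb; rewrite -/(rho w) /moment_gap.
rewrite (Jf (fun x => x `^ q)) ?powR0 ?gt_eqF //.
set S := \sum_(k < N w | J k) _.
have S0 : 0 <= S by apply: sumr_ge0 => k _; exact: powR_ge0.
have -> : rho w `^ q - (M `^ q + S) = - S + (rho w `^ q - M `^ q) by ring.
by rewrite (le_trans (ler_normD _ _)) // normrN (ger0_norm S0).
Qed.

Lemma measurable_moment_gap : measurable_fun setT moment_gap.
Proof.
apply: measurable_funB; first exact/measurable_fun_powR/measurable_rho.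
by apply: (measurable_sum_a (f := fun x => x `^ q)); exact: measurable_powR.
Qed.

Lemma moment_gap_lty : (Ex (fun w => `|moment_gap w|%R) < +oo)%E.
Proof.
have [K [K0 EK]] : exists K, 0 <= K /\ Ex (remainder N T X Q p q) = K%:E.
  by apply: Ex_EFin; [move=> w; exact: remainder_ge0|exact: remainder_lty H _ _ G].
have c0 : 0 <= max_const q by rewrite /max_const addr_ge0 // !mulr_ge0 ?powR_ge0 // ltW.
apply: (@Ex_lty_le _ _ _ _ _ (fun w => max_const q * remainder N T X Q p q w)) => //.
- by apply: measurable_fun_normr; exact: measurable_moment_gap.
- by apply: measurable_funM => //; exact: measurable_remainder H _ _.
- by move=> w; exact: moment_gap_le.
rewrite ExZ // ?EK; first by rewrite -EFinM ltry.
- exact: measurable_remainder H _ _.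
- by move=> w; exact: remainder_ge0.
Qed.

End delta.

Section one_step.
Variables (p q e mq m1 : R).
Hypotheses (e0 : 0 < e) (eltq : e < q) (G : good_exponents P N T Q X0 p (q + e)).
Hypothesis Emq : Ex (fun w => pow_sum (N w) (fun k => `|T k w|) q) = mq%:E.
Hypothesis Em1 : Ex (fun w => pow_sum (N w) (fun k => `|T k w|) (q - e)) = m1%:E.
Hypothesis mq1 : 1 <= mq.
Hypothesis mqm1 : m1 < mq.

Let q0 : 0 < q. Proof. exact: lt_trans e0 eltq. Qed.
Let mX0a : measurable_fun setT (fun w => `|X0 w|).
Proof. by apply: measurable_fun_normr; exact: (measurable_solution H). Qed.

Let C : R := max_const (q + e).
Let C0 : 0 <= C.
Proof. by rewrite /C /max_const addr_ge0 // !mulr_ge0 ?powR_ge0 // ltW // addr_gt0. Qed.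

Lemma remainder_EFin : exists K, 0 <= K /\ Ex (remainder N T X Q p (q + e)) = K%:E.
Proof.
by apply: Ex_EFin; [move=> w; exact: remainder_ge0|exact: remainder_lty H _ _ G].
Qed.

(** The tilting argument at an order [q] whose moment is finite: the mean of
    [tilt `|X0|] is finite, and it occurs with the coefficient [mq] on the side
    of the sums and 1 on that of [rho], so that [1 <= mq] makes it drop out. *)
Lemma moment_step : (Ex (fun w => (`|X0 w| `^ q)%R) < +oo)%E ->
  (Ex (fun w => (`|X0 w| `^ (q + e))%R) < +oo)%E.
Proof.
move=> EXq; have [p0 p1 ps _ _] := G; have [K [K0 EK]] := remainder_EFin.
suff : (Ex (fun w => (`|X0 w| `^ (q + e))%R) <= (C * K / (mq - m1))%:E)%E.
  by move/le_lt_trans; apply; rewrite ltry.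
apply: Ex_powR_le_gain; first exact: (measurable_solution H).
move=> eta eta0; have eta0' := ltW eta0.
have mt := @measurable_tilt R q e eta eta0'.
have mg := @measurable_gain R q e eta eta0'.
have mtX : measurable_fun setT (fun w => tilt q e eta `|X0 w|) by exact: measurableT_comp.
have mgX : measurable_fun setT (fun w => gain q e eta `|X0 w|) by exact: measurableT_comp.
have Et : (Ex (fun w => tilt q e eta `|X0 w|) < +oo)%E.
  apply: (@Ex_lty_le _ _ _ _ _ (fun w => eta^-1 * `|X0 w| `^ q)) => //.
  - by apply: measurable_funM => //; exact: measurable_fun_powR.
  - by move=> w; exact: tilt_ge0.
  - by move=> w; rewrite mulrC; exact: tilt_le_powR_div.
  apply: Ex_lty_scale => //; first exact: measurable_fun_powR.
  by rewrite invr_ge0.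
have Eg : (Ex (fun w => gain q e eta `|X0 w|) < +oo)%E.
  apply: (@Ex_lty_le _ _ _ _ _ (fun w => tilt q e eta `|X0 w|)) => //.
    by move=> w; exact: gain_ge0.
  by move=> w; exact: gain_le_tilt.
have [h [h0 Eh]] := Ex_EFin (fun w => tilt_ge0 q e `|X0 w| eta0') Et.
have [g [g0 Egg]] := Ex_EFin (fun w => gain_ge0 q e `|X0 w| eta0') Eg.
rewrite Egg lee_fin ler_pdivlMr ?subr_gt0 //.
have mST : measurable_fun setT (fun w => \sum_(k < N w) tilt q e eta (a k w)).
  exact: measurable_sum_a.
have mR := measurable_remainder H p (q + e).
have mA r (f : R -> R) : measurable_fun setT f ->
    measurable_fun setT (fun w => \sum_(k < N w) `|T k w| `^ r * f `|X k w|).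
  move=> mf; apply: (@measurable_random_sum _ _ _ N (fun k w => `|T k w| `^ r * f `|X k w|)).
    exact: (measurable_number H).
  move=> k; apply: measurable_funM.
    apply: measurable_fun_powR; apply: measurable_fun_normr; exact: (measurable_weight H).
  by apply: (measurableT_comp mf); apply: measurable_fun_normr; exact: (measurable_copy H).
have t0' x : 0 <= tilt q e eta x by exact: tilt_ge0.
have g0' x : 0 <= gain q e eta x by exact: gain_ge0.
have A0 r (f : R -> R) w : (forall x, 0 <= f x) ->
    0 <= \sum_(k < N w) `|T k w| `^ r * f `|X k w|.
  by move=> f0; apply: sumr_ge0 => k _; rewrite mulr_ge0 ?powR_ge0.
have mrt : measurable_fun setT (fun w => tilt q e eta (rho w)).
  by apply: (measurableT_comp mt); exact: measurable_rho.
have key : (Ex (fun w => (\sum_(k < N w) `|T k w| `^ q * tilt q e eta `|X k w| +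
    \sum_(k < N w) `|T k w| `^ q * gain q e eta `|X k w|)%R) <=
  Ex (fun w => ((tilt q e eta (rho w) + C * remainder N T X Q p (q + e) w) +
    \sum_(k < N w) `|T k w| `^ (q - e) * gain q e eta `|X k w|)%R))%E.
  apply: Ex_le.
  - by apply: measurable_funD; exact: mA.
  - apply: measurable_funD; last exact: mA.
    by apply: measurable_funD => //; exact: measurable_funM.
  - by move=> w; rewrite addr_ge0 ?A0.
  - move=> w; apply: le_trans (lerD (sum_tilt_le w q0 e0 eta0 p0 p1 ps) (lexx _)).
    rewrite -!big_split /=; apply: ler_sum => k _.
    by rewrite -mulrDr /a normrM tilt_scale.
have mCR : measurable_fun setT (fun w => C * remainder N T X Q p (q + e) w).
  exact: measurable_funM.
have CR0 w : 0 <= C * remainder N T X Q p (q + e) w by rewrite mulr_ge0 ?remainder_ge0.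
have mtCR : measurable_fun setT
    (fun w => tilt q e eta (rho w) + C * remainder N T X Q p (q + e) w).
  exact: measurable_funD.
have tCR0 w : 0 <= tilt q e eta (rho w) + C * remainder N T X Q p (q + e) w.
  by rewrite addr_ge0.
move: key; rewrite !ExD //; try exact: mA; try by move=> w; exact: A0.
rewrite (wald_pow Emq mt t0' Eh) (wald_pow Emq mg g0' Egg) (wald_pow Em1 mg g0' Egg).
rewrite Ex_rho // Eh ExZ ?EK //; last by move=> w; exact: remainder_ge0.
rewrite -!EFinM -!EFinD lee_fin; have : 0 <= (mq - 1) * h by rewrite mulr_ge0 ?subr_ge0.
by rewrite mulrBr; lra.
Qed.

Let delta := moment_gap q.

(** The tilting argument when only moments of order below [q] are finite. The
    function [tilt] is replaced by the integrable [defect], and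
    [tilt rho - \sum_k tilt (a k)] by the same difference for [- defect] plus
    [moment_gap / eta]. The positive and negative parts of the latter are
    compared separately, so that only nonnegative functions are averaged. *)
Lemma critical_step : p <= q -> mq = 1 ->
  (Ex (fun w => (`|X0 w| `^ (q - e))%R) < +oo)%E ->
  (Ex (fun w => Num.max (delta w) 0%R) <= Ex (fun w => Num.max (- delta w)%R 0%R))%E ->
  (Ex (fun w => (`|X0 w| `^ (q + e))%R) < +oo)%E.
Proof.
move=> pq mqE EXq Hdelta; have [p0 p1 ps _ _] := G; have [K [K0 EK]] := remainder_EFin.
have Emq1 : Ex (fun w => pow_sum (N w) (fun k => `|T k w|) q) = 1%:E by rewrite Emq mqE.
have m11 : 0 < 1 - m1 by rewrite subr_gt0 -mqE.
suff : (Ex (fun w => (`|X0 w| `^ (q + e))%R) <= (C * K / (1 - m1))%:E)%E.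
  by move/le_lt_trans; apply; rewrite ltry.
apply: Ex_powR_le_gain; first exact: (measurable_solution H).
move=> eta eta0; have eta0' := ltW eta0.
have mt := @measurable_defect R q e eta eta0'.
have mg := @measurable_gain R q e eta eta0'.
have t0' x : 0 <= defect q e eta x by exact: defect_ge0.
have g0' x : 0 <= gain q e eta x by exact: gain_ge0.
have mtX : measurable_fun setT (fun w => defect q e eta `|X0 w|) by exact: measurableT_comp.
have mgX : measurable_fun setT (fun w => gain q e eta `|X0 w|) by exact: measurableT_comp.
have mXqe : measurable_fun setT (fun w => (eta ^+ 2)^-1 * `|X0 w| `^ (q - e)).
  by apply: measurable_funM => //; exact: measurable_fun_powR.
have Ebig : (Ex (fun w => ((eta ^+ 2)^-1 * `|X0 w| `^ (q - e))%R) < +oo)%E.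
  apply: Ex_lty_scale => //; first exact: measurable_fun_powR.
  by rewrite invr_ge0 exprn_ge0.
have Et : (Ex (fun w => defect q e eta `|X0 w|) < +oo)%E.
  apply: (Ex_lty_le mtX mXqe _ _ Ebig) => // w.
  by rewrite mulrC; exact: defect_le.
have Eg : (Ex (fun w => gain q e eta `|X0 w|) < +oo)%E.
  apply: (Ex_lty_le mgX mXqe _ _ Ebig) => // w.
  by rewrite mulrC; exact: gain_le.
have [c [c0 Ec]] := Ex_EFin (fun w => t0' `|X0 w|) Et.
have [g [g0 Egg]] := Ex_EFin (fun w => g0' `|X0 w|) Eg.
rewrite Egg lee_fin ler_pdivlMr //.
have mST : measurable_fun setT (fun w => \sum_(k < N w) defect q e eta (a k w)).
  exact: measurable_sum_a.
have mR := measurable_remainder H p (q + e).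
have mA r (f : R -> R) : measurable_fun setT f ->
    measurable_fun setT (fun w => \sum_(k < N w) `|T k w| `^ r * f `|X k w|).
  move=> mf; apply: (@measurable_random_sum _ _ _ N (fun k w => `|T k w| `^ r * f `|X k w|)).
    exact: (measurable_number H).
  move=> k; apply: measurable_funM.
    apply: measurable_fun_powR; apply: measurable_fun_normr; exact: (measurable_weight H).
  by apply: (measurableT_comp mf); apply: measurable_fun_normr; exact: (measurable_copy H).
have A0 r (f : R -> R) w : (forall x, 0 <= f x) ->
    0 <= \sum_(k < N w) `|T k w| `^ r * f `|X k w|.
  by move=> f0; apply: sumr_ge0 => k _; rewrite mulr_ge0 ?powR_ge0.
have S0 w : 0 <= \sum_(k < N w) defect q e eta (a k w) by exact: sumr_ge0.
have mrt : measurable_fun setT (fun w => defect q e eta (rho w)).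
  by apply: (measurableT_comp mt); exact: measurable_rho.
have mCR : measurable_fun setT (fun w => C * remainder N T X Q p (q + e) w).
  exact: measurable_funM.
have CR0 w : 0 <= C * remainder N T X Q p (q + e) w by rewrite mulr_ge0 ?remainder_ge0.
have key : (Ex (fun w => (\sum_(k < N w) defect q e eta (a k w) +
    \sum_(k < N w) `|T k w| `^ q * gain q e eta `|X k w|)%R) <=
  Ex (fun w => (\sum_(k < N w) `|T k w| `^ q * defect q e eta `|X k w| +
    \sum_(k < N w) `|T k w| `^ (q - e) * gain q e eta `|X k w|)%R))%E.
  apply: Ex_le.
  - by apply: measurable_funD => //; exact: mA.
  - by apply: measurable_funD; exact: mA.
  - by move=> w; rewrite addr_ge0 ?A0.
  - move=> w; rewrite -!big_split /=; apply: ler_sum => k _.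
    by rewrite /a normrM defect_scale.
move: key; rewrite !ExD //; try exact: mA; try by move=> w; exact: A0.
rewrite (wald_pow Emq1 mt t0' Ec) (wald_pow Emq1 mg g0' Egg) (wald_pow Em1 mg g0' Egg).
rewrite -EFinD.
have ES0 : (0 <= Ex (fun w => (\sum_(k < N w) defect q e eta (a k w))%R))%E by exact: Ex_ge0.
move=> key.
have [S ES] : exists S, Ex (fun w => (\sum_(k < N w) defect q e eta (a k w))%R) = S%:E.
  case E : (Ex _) => [S| |]; first by exists S.
    by rewrite E in key.
  by rewrite E in ES0.
rewrite ES -EFinD lee_fin in key.
pose dp w := eta^-1 * Num.max (delta w) 0.
pose dm w := eta^-1 * Num.max (- delta w) 0.
have md : measurable_fun setT delta by exact: measurable_moment_gap.
have G' : good_exponents P N T Q X0 p q.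
  by apply: (good_exponents_le H _ _ G) => //; rewrite lerDl ltW.
have mmp : measurable_fun setT (fun w => Num.max (delta w) 0) by exact: measurable_maxr.
have mmm : measurable_fun setT (fun w => Num.max (- delta w) 0).
  by apply: measurable_maxr => //; exact: measurableT_comp.
have dmf : (Ex (fun w => Num.max (- delta w)%R 0%R) < +oo)%E.
  apply: (Ex_lty_le mmm _ _ _ (moment_gap_lty G')).
  - exact: measurable_fun_normr.
  - by move=> w; rewrite le_max lexx orbT.
  - by move=> w; rewrite ge_max normr_ge0 andbT -normrN ler_norm.
have p0' w : 0 <= Num.max (delta w) 0 by rewrite le_max lexx orbT.
have m0' w : 0 <= Num.max (- delta w) 0 by rewrite le_max lexx orbT.
have [u [u0 Eu]] := Ex_EFin m0' dmf.
have [v [v0 Ev]] := Ex_EFin p0' (le_lt_trans Hdelta dmf).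
rewrite Eu Ev lee_fin in Hdelta.
have ieta0 : 0 <= eta^-1 by rewrite invr_ge0.
have mdp : measurable_fun setT dp by exact: measurable_funM.
have mdm : measurable_fun setT dm by exact: measurable_funM.
have dp0 w : 0 <= dp w by rewrite mulr_ge0.
have dm0 w : 0 <= dm w by rewrite mulr_ge0.
have key2 : (Ex (fun w => (defect q e eta (rho w) + dm w)%R) <=
  Ex (fun w => ((\sum_(k < N w) defect q e eta (a k w) + dp w) +
     C * remainder N T X Q p (q + e) w)%R))%E.
  apply: Ex_le.
  - exact: measurable_funD.
  - by apply: measurable_funD => //; exact: measurable_funD.
  - by move=> w; rewrite addr_ge0.
  - move=> w; have := sum_tilt_le w q0 e0 eta0 p0 p1 ps.
    have -> : \sum_(k < N w) tilt q e eta (a k w) =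
      eta^-1 * (\sum_(k < N w) a k w `^ q) - \sum_(k < N w) defect q e eta (a k w).
      rewrite mulr_sumr -sumrB; apply: eq_bigr => k _.
      by rewrite tilt_defect // [eta^-1 * _]mulrC.
    rewrite tilt_defect // -/C [_ / eta]mulrC.
    have dd : dp w - dm w = eta^-1 * rho w `^ q - eta^-1 * \sum_(k < N w) a k w `^ q.
      rewrite /dp /dm -!mulrBr; congr (_ * _).
      rewrite -[RHS]/(delta w); have [d0|/ltW d0] := leP 0 (delta w).
        by rewrite max_r ?subr0 // oppr_le0.
      by rewrite max_l ?oppr_ge0 // sub0r opprK.
    by lra.
move: key2; rewrite !ExD //; last 2 first.
- exact: measurable_funD.
- by move=> w; rewrite addr_ge0.
have Edm : Ex dm = (eta^-1 * u)%:E.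
  by rewrite (@ExZ _ _ _ P eta^-1 (fun w => Num.max (- delta w) 0)) // Eu -EFinM.
have Edp : Ex dp = (eta^-1 * v)%:E.
  by rewrite (@ExZ _ _ _ P eta^-1 (fun w => Num.max (delta w) 0)) // Ev -EFinM.
rewrite Ex_rho // Ec ES Edm Edp ExZ // ?EK; last by move=> w; exact: remainder_ge0.
rewrite -!EFinM -!EFinD lee_fin => key2.
have : 0 <= eta^-1 * (u - v) by rewrite mulr_ge0 // subr_ge0.
rewrite mulrBr !mul1r in key *; lra.
Qed.

End one_step.
End tilting.

(** * The constant as an expectation *)

Section layer.
Context (R : realType).
Implicit Types (b t beta : R).
Local Notation leb := (@lebesgue_measure R).

(** The layer-cake density of [b `^ beta / beta] over the levels [t] ([integral_layer]). *)
Definition layer beta b t : R := (0 < t)%R%:R * t `^ (beta - 1) * (t < b)%R%:R.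

Lemma layer_ge0 beta b t : 0 <= layer beta b t.
Proof. by rewrite !mulr_ge0 ?powR_ge0. Qed.

Lemma measurable_ltr_nat d (U : measurableType d) (f g : U -> R) :
  measurable_fun setT f -> measurable_fun setT g ->
  measurable_fun setT (fun z => (f z < g z)%R%:R : R).
Proof.
move=> mf mg; rewrite (_ : (fun z => _) = \1_[set z | f z < g z]).
  apply: measurable_indic.
  have := measurable_fun_ltr mf mg measurableT (Y := [set true]) I.
  by rewrite setTI.
by apply/funext => z; rewrite indicE; congr (nat_of_bool _)%:R; apply/idP/idP; rewrite inE.
Qed.

Lemma measurable_layer beta b : measurable_fun setT (layer beta b : measurableTypeR R -> R).
Proof.
apply: measurable_funM; last exact: measurable_ltr_nat.
by apply: measurable_funM; [exact: measurable_ltr_nat|exact: measurable_powR].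
Qed.

Lemma integral_powR_itv (c b beta : R) : 0 < c -> c < b -> 0 < beta ->
  (\int[leb]_(t in `[c, b]) (t `^ (beta - 1))%:E = ((b `^ beta - c `^ beta) / beta)%:E)%E.
Proof.
move=> c0 cb beta0; have b0 := lt_trans c0 cb.
have cont x r : 0 < x -> {for x, continuous (fun t : R => t `^ r)}.
  move=> x0; apply: differentiable_continuous; apply/derivable1_diffP.
  by apply: derivable_powR; rewrite in_itv /= andbT.
have contF x : 0 < x -> {for x, continuous (fun t : R => t `^ beta / beta)}.
  by move=> x0; apply: cvgMl; exact: cont.
rewrite (@continuous_FTC2 _ _ (fun t => t `^ beta / beta) _ _ cb) //.
- by rewrite -EFinB mulrBl.
- apply: continuous_in_subspaceT => x; rewrite inE /= in_itv /= => /andP[cx _].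
  by apply: cont; exact: lt_le_trans cx.
- split.
  + move=> x; rewrite in_itv /= => /andP[cx _].
    have x0 := lt_trans c0 cx.
    by apply: derivableM => //; apply: derivable_powR; rewrite in_itv /= andbT.
  + by apply: cvg_at_right_filter; exact: contF.
  + by apply: cvg_at_left_filter; exact: contF.
- move=> x; rewrite in_itv /= => /andP[cx _]; have x0 := lt_trans c0 cx.
  rewrite derive1Mr; last by apply: derivable_powR; rewrite in_itv /= andbT.
  rewrite powR_derive1 ?in_itv /= ?andbT // mulrAC mulfV ?mul1r // gt_eqF //.
Qed.

Lemma integral_layer beta b : 0 < beta -> 0 <= b ->
  (\int[leb]_t (layer beta b t)%:E = (b `^ beta / beta)%:E)%E.
Proof.
move=> beta0; rewrite le_eqVlt => /predU1P[<-|b0].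
  rewrite powR0 ?gt_eqF // mul0r (eq_integral (cst 0%E)) ?integral0 // => t _.
  rewrite /layer; have [t0|t0] := ltP 0 t; last by rewrite !mul0r.
  by rewrite ltNge (ltW t0) /= mulr0.
pose F (n : nat) : set R := `[b / n.+2%:R, b]%classic.
have FU : \bigcup_n F n = `]0, b]%classic.
  apply/seteqP; split => [x [n _]|x] /=.
    rewrite /F /= !in_itv /= => /andP[h ->]; rewrite andbT.
    by apply: lt_le_trans h; rewrite divr_gt0.
  rewrite in_itv /= => /andP[x0 xb].
  exists (Num.truncn (b / x)) => //; rewrite /F /= in_itv /= xb andbT.
  rewrite ler_pdivrMr // mulrC -ler_pdivrMr // ltW //.
  by rewrite (lt_trans (truncnS_gt _)) // ltr_nat.
have ndF : {homo F : n m / (n <= m)%N >-> (n <= m)%O}.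
  move=> n m nm; apply/subsetPset => z; rewrite /F /= !in_itv /= => /andP[h ->].
  by rewrite andbT (le_trans _ h) // ler_pM2l // lef_pV2 ?posrE // ler_nat !ltnS.
have mF i : measurable (F i) by exact: measurable_itv.
(* The power may be unbounded at 0: exhaust the interval from the right. *)
pose g (t : measurableTypeR R) : \bar R := (t `^ (beta - 1))%:E.
have mg : measurable_fun setT g by apply/measurable_EFinP; exact: measurable_powR.
have := @ge0_nondecreasing_set_cvg_integral _ (measurableTypeR R) R F g leb ndF mF
  (fun n => measurable_funS measurableT (@subsetT _ _) mg)
  (fun _ _ _ => powR_ge0 _ _).
rewrite FU => cv1.
have cv2 : (\int[leb]_(x in F i) g x)%E @[i --> \oo] --> (b `^ beta / beta)%:E.
  rewrite (_ : (fun i => _) = fun i : nat => (((b `^ beta - (b / i.+2%:R) `^ beta) / beta)%:E)).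
    apply: cvg_EFin; first exact: nearW.
    apply: cvgMl; rewrite -[X in _ --> X]subr0; apply: cvgB; first exact: cvg_cst.
    have /cvg_at_rightP := @powR_cvg0 R beta beta0; apply; split.
      by move=> n; rewrite divr_gt0.
    rewrite -(mulr0 b); apply: cvgMr.
    have := @cvg_harmonic R; rewrite -(cvg_shiftn 1) /=.
    by under eq_fun do rewrite addn1.
  apply/funext => i; rewrite /F integral_powR_itv ?divr_gt0 //.
  by rewrite ltr_pdivrMr // ltr_pMr // ltr1n.
have <- := cvg_unique (@ereal_hausdorff R) cv1 cv2.
rewrite -integral_itv_bndo_bndc; last first.
  by apply: measurable_funS mg.
rewrite [RHS]integral_mkcond; apply: eq_integral => t _.
rewrite /layer patchE; case: ifPn.
  by rewrite inE /= in_itv /= => /andP[-> ->]; rewrite mul1r mulr1.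
rewrite notin_setE /= in_itv /= => /negP; rewrite negb_and => /orP[/negbTE->|/negbTE->].
  by rewrite !mul0r.
by rewrite mulr0.
Qed.

End layer.

Section constant.
Context d (Om : measurableType d) (R : realType) (P : probability Om R).
Context (GT GX : set (set Om)) (N : Om -> nat) (T X : nat -> Om -> R) (Q X0 : Om -> R).
Notation Ex f := (expectation P f).
Local Notation leb := (@lebesgue_measure R).
Hypothesis H : weighted_model P GT GX N T X Q X0.
Hypothesis HL : eq_in_law P X0 (fun w => \sum_(k < N w) T k w * X k w + Q w).
Hypothesis HN : {ae P, forall w, forall k, (N w <= k)%N -> T k w = 0}.
Variables (p beta s : R).
Hypothesis beta0 : 0 < beta.
Hypothesis G : good_exponents P N T Q X0 p beta.
Hypothesis s0 : 0 < s.
Hypothesis EXs : (Ex (fun w => (\sum_(k < N w) `|T k w * X k w| `^ s)%R) < +oo)%E.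

Let a k w : R := `|T k w * X k w|.
Let rho w : R := `|\sum_(k < N w) T k w * X k w + Q w|.
Let delta : Om -> R := moment_gap N T X Q beta.

Let ma k : measurable_fun setT (a k).
Proof. by apply: measurable_fun_normr; exact: (measurable_term H). Qed.

Let mrho : measurable_fun setT rho. Proof. exact: measurable_rho H. Qed.

Definition tail_count (t : R) w : R := \sum_(k < N w) (t < a k w)%R%:R.

(** Its integral over the sample space is the integrand of the constant K, and
    its integral over the levels is [delta / beta]. *)
Definition kernel (z : measurableTypeR R * Om) : R :=
  (0 < z.1)%R%:R * z.1 `^ (beta - 1) * ((z.1 < rho z.2)%R%:R - tail_count z.1 z.2).

Lemma kernelE t w : kernel (t, w) =
  layer beta (rho w) t - \sum_(k < N w) layer beta (a k w) t.
Proof. by rewrite /kernel /layer /tail_count mulrBr mulr_sumr. Qed.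

Lemma measurable_kernel : measurable_fun setT kernel.
Proof.
have m1 : measurable_fun setT (fst : measurableTypeR R * Om -> R) by exact: measurable_fst.
have m2 : measurable_fun setT (snd : measurableTypeR R * Om -> Om) by exact: measurable_snd.
apply: measurable_funM.
  apply: measurable_funM; first exact: measurable_ltr_nat.
  exact: measurable_fun_powR.
apply: measurable_funB.
  by apply: measurable_ltr_nat => //; exact: measurableT_comp.
rewrite /tail_count.
apply: (@measurable_random_sum _ _ _ (fun z : measurableTypeR R * Om => N z.2)
   (fun k z => (z.1 < a k z.2)%R%:R)).
  move=> k; have := m2 measurableT _ (measurable_number H k).
  by rewrite setTI.
by move=> k; apply: measurable_ltr_nat => //; exact: measurableT_comp.
Qed.

(** The absolute integrability that Fubini's theorem needs, even if the powers
    of [rho] and of the terms are not integrable. The layer of the largest term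
    [M] cancels against that of [rho] except between these two levels, and
    [max_term_split] bounds what is left. *)
Lemma integral_kernel_abs w : (\int[leb]_t `|kernel (t, w)|%:E <=
  (max_const beta * remainder N T X Q p beta w / beta)%:E)%E.
Proof.
have [p0 p1 pb _ _] := G.
have [M [J [M0 Jf Jb]]] :=
  @max_term_split R (N w) (fun k => T k w * X k w) (Q w) p beta p0 p1 pb.
rewrite -/(rho w) in Jb.
have rho0 : 0 <= rho w by exact: normr_ge0.
pose u := Num.max (rho w) M; pose v := Num.min (rho w) M.
have v0 : 0 <= v by rewrite le_min rho0.
have u0 : 0 <= u by rewrite le_max rho0.
have mker : measurable_fun setT (fun t : measurableTypeR R => `|kernel (t, w)|).
  by apply: measurable_fun_normr; exact: (measurable_fun_pair1 w measurable_kernel).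
have mJ : measurable_fun setT (fun t : measurableTypeR R => \sum_(k < N w | J k) layer beta (a k w) t).
  rewrite (_ : (fun t => _) = fun t => \sum_(k < N w) (J k)%:R * layer beta (a k w) t).
    by apply: measurable_sum => k; apply: measurable_funM => //; exact: measurable_layer.
  apply/funext => t; rewrite big_mkcond; apply: eq_bigr => k _.
  by case: ifP; rewrite ?mul1r ?mul0r.
have J0 t : 0 <= \sum_(k < N w | J k) layer beta (a k w) t.
  by apply: sumr_ge0 => k _; exact: layer_ge0.
have pt t : `|kernel (t, w)| + layer beta v t <=
    layer beta u t + \sum_(k < N w | J k) layer beta (a k w) t.
  rewrite kernelE.
  have l0 : layer beta 0 t = 0.
    by rewrite /layer; case: (ltgtP 0 t) => //= _; rewrite ?mulr0 ?mul0r.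
  rewrite (Jf (fun x => layer beta x t) l0).
  set S := \sum_(k < N w | J k) _.
  have SJ : 0 <= S by exact: J0.
  have -> : layer beta (rho w) t - (layer beta M t + S) =
     (layer beta (rho w) t - layer beta M t) - S by ring.
  have := ler_normB (layer beta (rho w) t - layer beta M t) S.
  rewrite (ger0_norm SJ) => h1.
  suff h2 : `|layer beta (rho w) t - layer beta M t| + layer beta v t <= layer beta u t by lra.
  have mono x y : x <= y -> layer beta x t <= layer beta y t.
    move=> xy; rewrite /layer ler_wpM2l ?mulr_ge0 ?powR_ge0 // ler_nat.
    by case: (ltP t x) => // tx; rewrite (lt_le_trans tx xy).
  rewrite /u /v; have [xy|/ltW yx] := leP (rho w) M.
    by rewrite distrC ger0_norm ?subr_ge0 ?mono // subrK.
  by rewrite ger0_norm ?subr_ge0 ?mono // subrK.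
have e1 : (\int[leb]_t (`|kernel (t, w)| + layer beta v t)%:E =
    \int[leb]_t `|kernel (t, w)|%:E + (v `^ beta / beta)%:E)%E.
  under eq_integral do rewrite EFinD.
  rewrite ge0_integralD ?integral_layer //.
  - exact/measurable_EFinP.
  - by move=> t _; rewrite lee_fin layer_ge0.
  - by apply/measurable_EFinP; exact: measurable_layer.
have e2 : (\int[leb]_t (layer beta u t + \sum_(k < N w | J k) layer beta (a k w) t)%:E =
    ((u `^ beta + \sum_(k < N w | J k) a k w `^ beta) / beta)%:E)%E.
  under eq_integral do rewrite EFinD.
  rewrite ge0_integralD ?integral_layer //; last 4 first.
  - by move=> t _; rewrite lee_fin layer_ge0.
  - by apply/measurable_EFinP; exact: measurable_layer.
  - by move=> t _; rewrite lee_fin.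
  - exact/measurable_EFinP.
  rewrite (eq_integral (fun t : measurableTypeR R =>
     \sum_(k < N w) (if J k then (layer beta (a k w) t)%:E else 0))%E); last first.
    by move=> t _; rewrite -sumEFin big_mkcond.
  rewrite ge0_integral_sum //; last 2 first.
  - by move=> k; case: (J k) => //; apply/measurable_EFinP; exact: measurable_layer.
  - by move=> k t _; case: (J k); rewrite // lee_fin layer_ge0.
  rewrite mulrDl EFinD mulr_suml -sumEFin [in RHS]big_mkcond; congr (_ + _)%E.
  apply: eq_bigr => k _; case: (J k); last by rewrite integral0.
  by rewrite integral_layer // normr_ge0.
have le12 : (\int[leb]_t (`|kernel (t, w)| + layer beta v t)%:E <=
    \int[leb]_t (layer beta u t + \sum_(k < N w | J k) layer beta (a k w) t)%:E)%E.
  apply: ge0_le_integral => //.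
  - by move=> t _; rewrite lee_fin addr_ge0 // layer_ge0.
  - by apply/measurable_EFinP; apply: measurable_funD => //; exact: measurable_layer.
  - by apply/measurable_EFinP; apply: measurable_funD => //; exact: measurable_layer.
  - by move=> t _; rewrite lee_fin.
rewrite e1 e2 in le12.
have le3 : (\int[leb]_t `|kernel (t, w)|%:E <=
    ((u `^ beta + \sum_(k < N w | J k) a k w `^ beta) / beta)%:E - (v `^ beta / beta)%:E)%E.
  by rewrite leeBrDr.
apply: (le_trans le3); rewrite -EFinB lee_fin -mulrBl ler_pM2r ?invr_gt0 //.
apply: le_trans Jb.
have -> : u `^ beta - v `^ beta = `|rho w `^ beta - M `^ beta| :> R ->
  u `^ beta + \sum_(k < N w | J k) a k w `^ beta - v `^ beta <=
  \sum_(k < N w | J k) a k w `^ beta + `|rho w `^ beta - M `^ beta|.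
  by move=> <-; rewrite addrAC addrC.
by [].
have bm x y : 0 <= x -> x <= y -> x `^ beta <= y `^ beta.
  by move=> x0 xy; rewrite ge0_ler_powR ?nnegrE ?(ltW beta0) // (le_trans x0).
rewrite /u /v; have [xy|/ltW yx] := leP (rho w) M.
  by rewrite distrC ger0_norm // subr_ge0 bm.
by rewrite ger0_norm // subr_ge0 bm.
Qed.

Lemma integrable_layer b : 0 <= b -> leb.-integrable setT (fun t => (layer beta b t)%:E).
Proof.
move=> b0; apply/integrableP; split.
  by apply/measurable_EFinP; exact: measurable_layer.
under eq_integral do rewrite gee0_abs ?lee_fin ?layer_ge0 //.
by rewrite integral_layer // ltry.
Qed.

Lemma integral_kernel w : (\int[leb]_t (kernel (t, w))%:E = (delta w / beta)%:E)%E.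
Proof.
rewrite (eq_integral (fun t : measurableTypeR R => (layer beta (rho w) t)%:E -
   \sum_(k < N w) (layer beta (a k w) t)%:E)%E); last first.
  by move=> t _; rewrite kernelE EFinB sumEFin.
have i1 : leb.-integrable setT (fun t : measurableTypeR R => (layer beta (rho w) t)%:E).
  by apply: integrable_layer; exact: normr_ge0.
have i2 k : leb.-integrable setT (fun t => (layer beta (a k w) t)%:E).
  by apply: integrable_layer; exact: normr_ge0.
rewrite integralB //; last by apply: integrable_sum => // k _; exact: i2.
rewrite integral_layer ?normr_ge0 //.
rewrite ge0_integral_sum //; last 2 first.
- by move=> k; apply/measurable_EFinP; exact: measurable_layer.
- by move=> k t _; rewrite lee_fin layer_ge0.
rewrite (eq_bigr (fun k : 'I_(N w) => (a k w `^ beta / beta)%:E)); last first.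
  by move=> k _; rewrite integral_layer // normr_ge0.
by rewrite sumEFin -EFinB /delta /moment_gap mulrBl mulr_suml.
Qed.

Lemma integrable_kernel : (leb \x P)%E.-integrable setT (fun z => (kernel z)%:E).
Proof.
have mk : measurable_fun setT (fun z => (kernel z)%:E).
  by apply/measurable_EFinP; exact: measurable_kernel.
have cb0 : 0 <= max_const beta / beta.
  by rewrite divr_ge0 ?(ltW beta0) // /max_const addr_ge0 // !mulr_ge0 ?powR_ge0 // ltW.
apply/(@integrable21ltyP _ _ (measurableTypeR R) Om R leb P _ mk).
apply: (@le_lt_trans _ _ (Ex (fun w => max_const beta / beta * remainder N T X Q p beta w))).
  rewrite expectE; apply: ge0_le_integral => //.
  - by move=> w _; apply: integral_ge0.
  - apply: (@measurable_fun_fubini_tonelli_G _ _ (measurableTypeR R) Om R leb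
      (fun z => `|(kernel z)%:E|%E)) => //.
    exact: measurableT_comp.
  - by apply/measurable_EFinP; apply: measurable_funM => //; exact: measurable_remainder H _ _.
  - by move=> w _; rewrite mulrAC; exact: integral_kernel_abs.
rewrite ExZ //; [|exact: measurable_remainder H _ _|by move=> w; exact: remainder_ge0].
have [K [K0 ->]] := Ex_EFin (remainder_ge0 N T X Q p beta) (remainder_lty H G).
by rewrite -EFinM ltry.
Qed.

(** The hypothesis [HN] lets the infinite series of probabilities replace the
    sum over the indices below [N]. At a fixed level the expected number of
    exceedances is finite by Markov's inequality of order [s], so the difference
    may be integrated term by term. *)
Lemma integral_kernel_Om t : 0 < t -> (\int[P]_w (kernel (t, w))%:E =
  (P [set w | (t < `|X0 w|)%R] - \sum_(0 <= k <oo) P [set w | (t < `|T k w * X k w|)%R])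
   * (t `^ (beta - 1))%:E)%E.
Proof.
move=> t0.
have ma_ k : measurable_fun setT (fun w => (t < a k w)%R%:R : R) by exact: measurable_ltr_nat.
have mset (f : Om -> R) : measurable_fun setT f -> measurable [set w | t < f w].
  move=> mf; have := measurable_fun_ltr (measurable_cst t) mf measurableT (Y := [set true]) I.
  by rewrite setTI.
have Pset (f : Om -> R) : measurable_fun setT f ->
    (\int[P]_w ((t < f w)%R%:R)%:E = P [set w | (t < f w)%R])%E.
  move=> mf; rewrite -[X in P X]setIT -integral_indic //; last exact: mset.
  apply: eq_integral => w _; rewrite indicE; congr (nat_of_bool _)%:R%:E.
  by apply/idP/idP; rewrite inE.
have mc : measurable_fun setT (tail_count t).
  exact: (@measurable_random_sum _ _ _ N (fun k w => (t < a k w)%R%:R) (measurable_number H)).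
have c0 w : 0 <= tail_count t w by exact: sumr_ge0.
have Ec : (\int[P]_w (tail_count t w)%:E = \sum_(0 <= k <oo) P [set w | (t < a k w)%R])%E.
  rewrite (@integral_random_sum _ _ _ P N (fun k w => (t < a k w)%R%:R) (measurable_number H)) //.
  apply: eq_eseriesr => k _; rewrite -Pset //.
  apply: ge0_ae_eq_integral => //.
  - apply/measurable_EFinP; apply: measurable_funM => //;
      exact: measurable_ltN (measurable_number H).
  - exact/measurable_EFinP.
  - by move=> w _; rewrite lee_fin mulr_ge0 ?ltN_ge0.
  - move: HN; apply: filterS => w hw _; rewrite /ltN.
    case: (ltnP k (N w)) => [|/hw e]; first by rewrite mul1r.
    by rewrite /a e (mul0r (X k w)) normr0 ltNge (ltW t0) mulr0.
have fc : (\int[P]_w (tail_count t w)%:E < +oo)%E.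
  rewrite -expectE.
  apply: (@Ex_lty_le _ _ _ _ _ (fun w => (t `^ s)^-1 * \sum_(k < N w) a k w `^ s)) => //.
  - apply: measurable_funM => //.
    apply: (@measurable_random_sum _ _ _ N (fun k w => a k w `^ s) (measurable_number H)) => k.
    exact: measurable_fun_powR.
  - move=> w; rewrite mulrC ler_pdivlMr ?powR_gt0 // mulr_suml; apply: ler_sum => k _.
    case: (ltP t (a k w)) => ta; last by rewrite mul0r powR_ge0.
    by rewrite mul1r ge0_ler_powR ?nnegrE ?(ltW s0) ?(ltW t0) ?(ltW ta) ?normr_ge0.
  apply: Ex_lty_scale => //.
  - apply: (@measurable_random_sum _ _ _ N (fun k w => a k w `^ s) (measurable_number H)) => k.
    exact: measurable_fun_powR.
  - by rewrite invr_ge0 powR_ge0.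
  - by move=> w; apply: sumr_ge0 => k _; exact: powR_ge0.
have Eu : (\int[P]_w ((t < rho w)%R%:R)%:E = P [set w | (t < `|X0 w|)%R])%E.
  rewrite Pset //.
  have mA : measurable [set x : R | t < `|x|].
    have := measurable_fun_ltr (measurable_cst t) (@normr_measurable R setT) measurableT (Y := [set true]) I.
    by rewrite setTI.
  exact/esym/(HL mA).
pose u w : R := (t < rho w)%R%:R.
have iu : P.-integrable setT (fun w => (u w)%:E).
  apply/integrableP; split; first by apply/measurable_EFinP; exact: measurable_ltr_nat.
  under eq_integral do rewrite gee0_abs ?lee_fin ?ler0n //.
  by rewrite Eu (le_lt_trans (probability_le1 _ _)) ?ltry //; apply: mset;
    apply: measurable_fun_normr; exact: (measurable_solution H).
have ic : P.-integrable setT (fun w => (tail_count t w)%:E).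
  apply/integrableP; split; first exact/measurable_EFinP.
  by under eq_integral do rewrite gee0_abs ?lee_fin //.
rewrite (eq_integral (fun w => ((t `^ (beta - 1))%:E * ((u w)%:E - (tail_count t w)%:E))%E));
  last first.
  by move=> w _; rewrite /kernel /= t0 mul1r EFinM EFinB.
rewrite integralZl //; last exact: integrableB.
by rewrite integralB // Eu Ec muleC.
Qed.

Lemma constantE :
  (\int[leb]_(t in `]0%R, +oo[) ((P [set w | (t < `|X0 w|)%R] -
     \sum_(0 <= k <oo) P [set w | (t < `|T k w * X k w|)%R]) * (t `^ (beta - 1))%:E)
   = \int[P]_w (delta w / beta)%:E)%E.
Proof.
under [RHS]eq_integral do rewrite -integral_kernel.
rewrite -(Fubini integrable_kernel) integral_mkcond; apply: eq_integral => t _.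
rewrite patchE; case: ifPn.
  by rewrite inE /= in_itv /= andbT => t0; rewrite integral_kernel_Om.
rewrite notin_setE /= in_itv /= andbT => /negP; rewrite -leNgt => t0.
rewrite (eq_integral (cst 0%E)) ?integral0 // => w _.
by rewrite /kernel /= ltNge t0 /= !mul0r.
Qed.

(** [constantE] split into positive and negative parts. *)
Lemma constant_le0 :
  ~ (0 < \int[leb]_(t in `]0%R, +oo[) ((P [set w | (t < `|X0 w|)%R] -
     \sum_(0 <= k <oo) P [set w | (t < `|T k w * X k w|)%R]) * (t `^ (beta - 1))%:E))%E ->
  (Ex (fun w => Num.max (delta w) 0%R) <= Ex (fun w => Num.max (- delta w)%R 0%R))%E.
Proof.
move=> K0; have b0 := ltW beta0.
have md : measurable_fun setT delta by exact: measurable_moment_gap H _.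
have pq : p <= beta by case: G.
have mmp : measurable_fun setT (fun w => Num.max (delta w) 0) by exact: measurable_maxr.
have mmm : measurable_fun setT (fun w => Num.max (- delta w) 0).
  by apply: measurable_maxr => //; exact: measurableT_comp.
have p0' w : 0 <= Num.max (delta w) 0 by rewrite le_max lexx orbT.
have m0' w : 0 <= Num.max (- delta w) 0 by rewrite le_max lexx orbT.
have mnd : measurable_fun setT (fun w => `|delta w|) by exact: measurable_fun_normr.
have dabs : (Ex (fun w => `|delta w|%R) < +oo)%E by exact: (moment_gap_lty H G).
have [u [u0 Eu]] := Ex_EFin m0' (Ex_lty_le mmm mnd m0'
  (fun w => ltac:(by rewrite ge_max normr_ge0 andbT -normrN ler_norm)) dabs).
have [v [v0 Ev]] := Ex_EFin p0' (Ex_lty_le mmp mnd p0'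
  (fun w => ltac:(by rewrite ge_max normr_ge0 andbT ler_norm)) dabs).
rewrite Eu Ev lee_fin leNgt; apply/negP => uv; apply: K0.
rewrite constantE.
have ip : P.-integrable setT (fun w => (Num.max (delta w) 0)%:E).
  apply/integrableP; split; first exact/measurable_EFinP.
  under eq_integral do rewrite gee0_abs ?lee_fin ?p0' //.
  by rewrite -expectE Ev ltry.
have im : P.-integrable setT (fun w => (Num.max (- delta w) 0)%:E).
  apply/integrableP; split; first exact/measurable_EFinP.
  under eq_integral do rewrite gee0_abs ?lee_fin ?m0' //.
  by rewrite -expectE Eu ltry.
rewrite (eq_integral (fun w => (beta^-1)%:E *
   ((Num.max (delta w) 0)%:E - (Num.max (- delta w) 0)%:E))%E); last first.
  move=> w _; rewrite -EFinB -EFinM mulrC; congr (_ * _)%:E.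
  have [d0|/ltW d0] := leP 0 (delta w).
    by rewrite max_r ?subr0 // oppr_le0.
  by rewrite max_l ?oppr_ge0 // sub0r opprK.
rewrite integralZl //; last exact: integrableB.
rewrite integralB // -!expectE Eu Ev -EFinB -EFinM lte_fin mulr_gt0 ?invr_gt0 //.
by rewrite subr_gt0.
Qed.
End constant.

(** * Strict convexity of the moments of the weights *)

Section convexity.
Context (R : realType).
Implicit Types (x a b c : R).

(** Dividing by [x `^ c] turns both assertions into [1 + u <= expR u], strict
    for [u != 0], used at two points whose weighted mean is 0. *)
Lemma powR_convex x a b c : 0 < a -> a < c -> c < b -> 0 <= x ->
  let l := (b - c) / (b - a) in
  x `^ c <= l * x `^ a + (1 - l) * x `^ b /\
  (ln x != 0 -> x `^ c < l * x `^ a + (1 - l) * x `^ b).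
Proof.
move=> a0 ac cb x0 l.
have l0 : 0 < l by rewrite divr_gt0 ?subr_gt0 // (lt_trans ac).
have l1 : l < 1.
  by rewrite ltr_pdivrMr ?mul1r ?subr_gt0 ?(lt_trans ac) // ltrD2l ltrN2.
have [->|xn0] := eqVneq x 0.
  have [c0 b0] : 0 < c /\ 0 < b by split; lra.
  rewrite !powR0 ?(gt_eqF a0) ?(gt_eqF b0) ?(gt_eqF c0) //.
  by rewrite !mulr0 addr0; split => //; rewrite ln0 // eqxx.
have xp : 0 < x by rewrite lt_neqAle eq_sym xn0.
have xE r : x `^ r = x `^ c * expR ((r - c) * ln x).
  by rewrite /powR (negbTE xn0) -expRD; congr expR; ring.
have xc0 : 0 < x `^ c by exact: powR_gt0.
have lz : l * ((a - c) * ln x) + (1 - l) * ((b - c) * ln x) = 0.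
  have ba : b - a != 0 by rewrite subr_eq0 gt_eqF // (lt_trans ac).
  by rewrite /l; field.
set u := (a - c) * ln x in lz *; set v := (b - c) * ln x in lz *.
have -> : l * x `^ a + (1 - l) * x `^ b =
   x `^ c * (l * expR u + (1 - l) * expR v).
  by rewrite (xE a) (xE b); ring.
have h1 := expR_ge1Dx u; have h2 := expR_ge1Dx v.
have k1 : 0 <= l * (expR u - (1 + u)) by rewrite mulr_ge0 ?subr_ge0 // ltW.
have k2 : 0 <= (1 - l) * (expR v - (1 + v)) by rewrite mulr_ge0 ?subr_ge0 // ltW.
split; first by rewrite ler_peMr ?(ltW xc0) //; lra.
move=> lx; rewrite ltr_pMr //.
have un0 : u != 0 by rewrite mulf_neq0 // subr_eq0 lt_eqF.
have k3 : 0 < l * (expR u - (1 + u)) by rewrite mulr_gt0 // subr_gt0 expR_gt1Dx.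
by lra.
Qed.

(** Subadditivity of the power [r^-1] applied to the numbers [f k `^ r]. *)
Lemma powR_sum_superadd n (f : nat -> R) r : (forall k, 0 <= f k) -> 1 <= r ->
  \sum_(k < n) f k `^ r <= (\sum_(k < n) f k) `^ r.
Proof.
move=> f0 r1; have r0 : 0 < r by lra.
have S0 : 0 <= \sum_(k < n) f k `^ r by apply: sumr_ge0 => k _; exact: powR_ge0.
have ir0 : 0 < r^-1 by rewrite invr_gt0.
have ir1 : r^-1 <= 1 by rewrite invf_le1.
have := @powR_sum_subadd R _ (index_enum 'I_n) predT (fun k => f k `^ r) r^-1
  (fun=> powR_ge0 _ _) ir0 ir1.
have -> : \sum_(i < n) (f i `^ r) `^ r^-1 = \sum_(i < n) f i.
  by apply: eq_bigr => k _; rewrite -powRrM mulfV ?gt_eqF // powRr1.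
move=> h; have : ((\sum_(k < n) f k `^ r) `^ r^-1) `^ r <= (\sum_(k < n) f k) `^ r.
  by rewrite ge0_ler_powR ?nnegrE ?powR_ge0 ?sumr_ge0 // ltW.
by rewrite -powRrM mulVf ?gt_eqF // powRr1.
Qed.

Lemma measurable_lattice (h : R) : measurable (lattice h).
Proof.
rewrite (_ : lattice h = \bigcup_(z : int) [set h * z%:~R]).
  by apply: countable_bigcupT_measurable => [|i]; [exact: countableP|exact: measurable_set1].
by apply/seteqP; split => x [z]; [exists z|move=> _ ->; exists z].
Qed.

End convexity.

Section moments_of_weights.
Context d (Om : measurableType d) (R : realType) (P : probability Om R).
Context (N : Om -> nat) (T : nat -> Om -> R).
Hypotheses (mNN : measurable_count N) (mTT : forall k, measurable_fun setT (T k)).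
Notation Ex f := (expectation P f).

Let W q w : R := pow_sum (N w) (fun k => `|T k w|) q.

Definition weight_moment q : \bar R := Ex (W q).

Let W_ge0 q w : 0 <= W q w. Proof. exact: pow_sum_ge0. Qed.

Lemma measurable_W q : measurable_fun setT (W q).
Proof. exact: measurable_pow_sum. Qed.

Lemma pow_sum_le_sum a c b w : 0 <= a -> a <= c -> c <= b -> W c w <= W a w + W b w.
Proof.
by move=> a0 ac cb; rewrite -big_split /=; apply: ler_sum => k _; exact: powR_le_sum.
Qed.

Lemma weight_moment_lty a c b : 0 <= a -> a <= c -> c <= b ->
  (weight_moment a < +oo)%E -> (weight_moment b < +oo)%E -> (weight_moment c < +oo)%E.
Proof.
move=> a0 ac cb ha hb; apply: (@Ex_lty_le _ _ _ _ _ (fun w => W a w + W b w)).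
- exact: measurable_W.
- by apply: measurable_funD; exact: measurable_W.
- exact: W_ge0.
- by move=> w; exact: pow_sum_le_sum.
apply: Ex_lty_add => //; try exact: measurable_W; try exact: W_ge0.
Qed.

(** Equality would force [ln |T k| = 0] almost surely on [k < N] for every [k],
    and 0 lies on every lattice. *)
Lemma weight_moment_strict_convex a b c (A B : R) : 0 < a -> a < c -> c < b ->
  (exists k, nonlattice (fun A => P [set w | A (ln `|T k w|) /\ (k < N w)%N])) ->
  weight_moment a = A%:E -> weight_moment b = B%:E ->
  exists C, weight_moment c = C%:E /\
    C < (b - c) / (b - a) * A + (1 - (b - c) / (b - a)) * B.
Proof.
move=> a0 ac cb [k nl] EA EB; set l := (b - c) / (b - a).
have l0 : 0 < l by rewrite divr_gt0 ?subr_gt0 // (lt_trans ac).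
have l1 : 0 < 1 - l.
  by rewrite subr_gt0 ltr_pdivrMr ?mul1r ?subr_gt0 ?(lt_trans ac) // ltrD2l ltrN2.
have Ec : (weight_moment c < +oo)%E.
  by apply: (@weight_moment_lty a c b); rewrite ?(ltW a0) ?(ltW ac) ?(ltW cb) ?EA ?EB ?ltry.
have [C [C0 EC]] := Ex_EFin (W_ge0 c) Ec.
exists C; split => //.
pose D w := l * W a w + (1 - l) * W b w - W c w.
have D0 w : 0 <= D w.
  rewrite subr_ge0 /W /pow_sum !mulr_sumr -big_split /=; apply: ler_sum => i _.
  exact: (powR_convex a0 ac cb (normr_ge0 _)).1.
have mW := measurable_W.
have mLR : measurable_fun setT (fun w => l * W a w + (1 - l) * W b w).
  by apply: measurable_funD; apply: measurable_funM.
have mD : measurable_fun setT D by exact: measurable_funB.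
have e1 : (Ex (fun w => (D w + W c w)%R) = (l * A + (1 - l) * B)%:E)%E.
  rewrite (@eq_Ex _ _ _ P _ (fun w => l * W a w + (1 - l) * W b w)); last first.
    by move=> w; rewrite /D subrK.
  rewrite ExD //; try exact: measurable_funM; try (by move=> w; rewrite mulr_ge0 ?W_ge0 ?ltW).
  rewrite (@ExZ _ _ _ P l (W a)) // ?(ltW l0) //.
  rewrite (@ExZ _ _ _ P (1 - l) (W b)) // ?(ltW l1) //.
  rewrite -[Ex (W a)]/(weight_moment a) -[Ex (W b)]/(weight_moment b) EA EB.
  by rewrite -!EFinM -EFinD.
rewrite ExD // in e1.
rewrite ltNge; apply/negP => le1.
have ED0 : Ex D = 0%E.
  move: e1; rewrite EC.
  have := @Ex_ge0 _ _ _ P D D0; case: (Ex D) => [x| |] //=.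
  rewrite lee_fin -EFinD => x0 [] h; congr EFin; apply/eqP; rewrite eq_le x0 andbT; lra.
have aeD : {ae P, forall w, D w = 0}.
  have mED : measurable_fun setT (EFin \o D) by exact/measurable_EFinP.
  have := (@ae_eq_integral_abs _ _ _ P setT measurableT _ mED).1.
  rewrite (_ : (\int[P]_(x in setT) _)%E = 0%E); last first.
    rewrite -ED0 expectE; apply: eq_integral => w _ /=.
    by rewrite ger0_norm.
  move=> /(_ erefl); apply: filterS => w /(_ I) /= [].
  by [].
have mS : measurable [set w | (~` lattice 1) (ln `|T k w|) /\ (k < N w)%N].
  apply: measurableI; last exact: mNN.
  have ml : measurable_fun setT (fun w => ln `|T k w|).
    by apply: (measurableT_comp (@measurable_ln R)); exact: measurable_fun_normr.
  rewrite -[X in measurable X]setTI; apply: ml => //.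
  by apply: measurableC; exact: measurable_lattice.
apply: (nl 1 ltr01).
case: aeD => Z [mZ PZ0 subZ].
apply/eqP; rewrite eq_le measure_ge0 andbT -PZ0.
apply: le_measure; rewrite ?inE //.
move=> w [lw kN]; apply: subZ => /= Dw0.
have : 0 < D w.
  rewrite subr_gt0 /W /pow_sum !mulr_sumr -big_split /=.
  rewrite (bigD1 (Ordinal kN)) //= [ltRHS](bigD1 (Ordinal kN)) //=.
  apply: ltr_leD.
    apply: (powR_convex a0 ac cb (normr_ge0 _)).2; apply/eqP => ln0.
    by apply: lw; exists 0; rewrite ln0 mulr0.
  by apply: ler_sum => i _; exact: (powR_convex a0 ac cb (normr_ge0 _)).1.
by rewrite Dw0 ltxx.
Qed.

End moments_of_weights.

(** * Propagation of finite moments *)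

Section extension.
Context d (Om : measurableType d) (R : realType) (P : probability Om R).
Context (GT GX : set (set Om)) (N : Om -> nat) (T X : nat -> Om -> R) (Q X0 : Om -> R).
Notation Ex f := (expectation P f).
Hypothesis H : weighted_model P GT GX N T X Q X0.
Hypothesis HL : eq_in_law P X0 (fun w => \sum_(k < N w) T k w * X k w + Q w).
Hypothesis HN : {ae P, forall w, forall k, (N w <= k)%N -> T k w = 0}.
Variables (alpha beta : R).
Hypotheses (alpha0 : 0 < alpha) (ab : alpha < beta).
Hypothesis Ea : weight_moment P N T alpha = 1%:E.
Hypothesis Eb : weight_moment P N T beta = 1%:E.
Hypothesis nl : exists k, nonlattice (fun A => P [set w | A (ln `|T k w|) /\ (k < N w)%N]).
Hypothesis HX : forall s, 0 <= s -> s < beta -> (Ex (fun w => (`|X0 w| `^ s)%R) < +oo)%E.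
Hypothesis HK : ~ (0 < \int[@lebesgue_measure R]_(t in `]0%R, +oo[)
   ((P [set w | (t < `|X0 w|)%R] -
     \sum_(0 <= k <oo) P [set w | (t < `|T k w * X k w|)%R]) * (t `^ (beta - 1))%:E))%E.

Let beta0 : 0 < beta. Proof. exact: lt_trans ab. Qed.
Let mTT := measurable_weight H.
Let mNN := measurable_number H.

Lemma weight_moment_gt1 q B : beta < q -> weight_moment P N T q = B%:E -> 1 < B.
Proof.
move=> bq EB.
have [C [EC]] := weight_moment_strict_convex mNN mTT alpha0 ab bq nl Ea EB.
move: EC; rewrite Eb => -[<-]; rewrite mulr1.
set l := (q - beta) / _ => h.
have l1 : 0 < 1 - l.
  by rewrite subr_gt0 ltr_pdivrMr ?mul1r ?subr_gt0 ?(lt_trans ab) // ltrD2l ltrN2.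
have : 0 < (1 - l) * (B - 1) by lra.
by rewrite (pmulr_rgt0 _ l1) subr_gt0.
Qed.

(** The moment is 1 at [alpha] and at least 1 at [q], so that strict convexity
    puts its value at [c] strictly below the one at [q]. *)
Lemma weight_moment_lt q c B : beta <= q -> alpha < c -> c < q ->
  weight_moment P N T q = B%:E -> 1 <= B /\
  exists C, weight_moment P N T c = C%:E /\ C < B.
Proof.
move=> bq ac cq EB.
have B1 : 1 <= B.
  move: bq; rewrite le_eqVlt => /predU1P[e|bq]; last exact/ltW/(weight_moment_gt1 bq EB).
  by move: EB; rewrite -e Eb => -[<-].
split => //.
have [C [EC h]] := weight_moment_strict_convex mNN mTT alpha0 ac cq nl Ea EB.
exists C; split => //; apply: lt_le_trans h _.
set l := (q - c) / _.
have l0 : 0 <= l by rewrite divr_ge0 // ?subr_ge0 ltW // (lt_trans ac).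
have : 0 <= l * (B - 1) by rewrite mulr_ge0 ?subr_ge0.
by rewrite mulrBr; lra.
Qed.

(** The power [s / p] is at least 1, hence superadditive. *)
Lemma weight_moment_good p s : good_exponents P N T Q X0 p s ->
  (weight_moment P N T s < +oo)%E.
Proof.
case=> p0 p1 ps _ [EW _]; apply: (Ex_lty_le _ _ _ _ EW).
- exact: measurable_W.
- exact/measurable_fun_powR/measurable_W.
- by move=> w; exact: pow_sum_ge0.
- move=> w; rewrite /pow_sum.
  rewrite (eq_bigr (fun k : 'I_(N w) => (`|T k w| `^ p) `^ (s / p))); last first.
    by move=> k _; rewrite -powRrM mulrC divfK // gt_eqF.
  apply: (@powR_sum_superadd R (N w) (fun k => `|T k w| `^ p)).
    by move=> k; exact: powR_ge0.
  by rewrite ler_pdivlMr ?mul1r.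
Qed.

(** Let [S] be the supremum of the orders of finite moments, and suppose that it
    is below [U]. The exponents [p] and [s] make the remainder integrable up to
    the order [s > S]. If [S = beta], [critical_step] reaches beyond [beta];
    otherwise [moment_step] from the order [S - e / 2] reaches [S + e / 2].
    Both contradict the choice of [S]. *)
Lemma moments_extend (U : \bar R) :
  (forall S, beta <= S -> (S%:E < U)%E -> exists p s, [/\ S < s, 0 < p, p <= 1, p < S &
     [/\ s - p < S,
       (Ex (fun w => (pow_sum (N w) (fun k => `|T k w|) p `^ (s / p))%R) < +oo)%E &
       (Ex (fun w => (`|Q w| `^ s)%R) < +oo)%E]]) ->
  forall s, 0 <= s -> (s%:E < U)%E -> (Ex (fun w => (`|X0 w| `^ s)%R) < +oo)%E.
Proof.
have [ab' alpha0' beta0'] : [/\ alpha < beta, 0 < alpha & 0 < beta] by split.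
move=> HU s0 s00 s0U; apply: contrapT => nfin.
pose F : set R := [set s | 0 <= s /\ (Ex (fun w => (`|X0 w| `^ s)%R) < +oo)%E].
have mXa : measurable_fun setT (fun w => `|X0 w|).
  by apply: measurable_fun_normr; exact: (measurable_solution H).
have down s t : 0 <= s -> s <= t -> (Ex (fun w => (`|X0 w| `^ t)%R) < +oo)%E ->
    (Ex (fun w => (`|X0 w| `^ s)%R) < +oo)%E.
  by move=> s_0 st; exact: Ex_powR_lty_le.
have Fub : ubound F s0.
  move=> s [s_0 Fs]; rewrite leNgt; apply/negP => ss; apply: nfin.
  by apply: down Fs => //; exact: ltW.
have F0 : F 0 by split => //; apply: HX.
have hsF : has_sup F by split; [exists 0|exists s0].
pose S := sup F.
have below s : 0 <= s -> s < S -> (Ex (fun w => (`|X0 w| `^ s)%R) < +oo)%E.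
  move=> s_0 sS; have /(sup_adherent) : 0 < S - s by rewrite subr_gt0.
  move=> /(_ F hsF) [t [t0 Ft]]; rewrite -/S subKr => st.
  by apply: down Ft => //; exact: ltW.
have hub : has_ubound F by exists s0.
have notF s : 0 <= s -> S < s -> ~ (Ex (fun w => (`|X0 w| `^ s)%R) < +oo)%E.
  move=> s_0 Ss Fs; have : s <= S by apply: (sup_ubound hub).
  by rewrite leNgt Ss.
have bS : beta <= S.
  rewrite leNgt; apply/negP => Sb.
  have S0 : 0 <= S by exact: (sup_ubound hub).
  apply: (notF ((S + beta) / 2)); [lra|lra|].
  by apply: HX; lra.
have SU : (S%:E < U)%E.
  by apply: le_lt_trans s0U; rewrite lee_fin; apply: ge_sup => //; exists 0.
have [p [s [Ss p0 p1 pS [sp EW EQ]]]] := HU S bS SU.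
have G : good_exponents P N T Q X0 p s.
  split => //; first lra.
  by split; apply: below => //; lra.
have Es := weight_moment_good G.
have [Sb|Sb] := eqVneq S beta.
- pose e := Num.min (s - beta) ((beta - alpha) / 2).
  have e0 : 0 < e by rewrite lt_min; apply/andP; split; lra.
  have e1 : e <= s - beta by rewrite ge_min lexx.
  have e2 : e <= (beta - alpha) / 2 by rewrite ge_min lexx orbT.
  have G1 : good_exponents P N T Q X0 p (beta + e).
    by apply: (good_exponents_le H _ _ G); rewrite -?Sb; lra.
  have G0 : good_exponents P N T Q X0 p beta.
    by apply: (good_exponents_le H _ _ G); rewrite -?Sb; lra.
  have [|||_ [m1 [Em1 m11]]] := @weight_moment_lt beta (beta - e) 1 _ _ _ Eb; try lra.
  have eb : e < beta by lra.
  apply: (notF (beta + e)); [lra|rewrite Sb; lra|].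
  apply: (critical_step H HL e0 eb G1 Eb Em1 m11) => //.
  + by rewrite -Sb ltW.
  + by apply: HX; lra.
  + apply: (constant_le0 H HL HN beta0 G0 alpha0 _ HK).
    have [c [c0 Ec]] := Ex_EFin (fun w => powR_ge0 `|X0 w| alpha) (HX (ltW alpha0) ab).
    rewrite (@eq_Ex _ _ _ P _ (fun w => \sum_(k < N w) `|T k w| `^ alpha * `|X k w| `^ alpha)).
      rewrite (wald_pow H (f := fun x => x `^ alpha) (c := c) Ea) ?ltry //.
      by move=> x; exact: powR_ge0.
    by move=> w; apply: eq_bigr => k _; rewrite normrM powRM.
- have bS' : beta < S by rewrite lt_neqAle eq_sym Sb.
  pose e := Num.min (s - S) ((S - beta) / 2).
  have e0 : 0 < e by rewrite lt_min; apply/andP; split; lra.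
  have e1 : e <= s - S by rewrite ge_min lexx.
  have e2 : e <= (S - beta) / 2 by rewrite ge_min lexx orbT.
  pose q := S - e / 2.
  have G1 : good_exponents P N T Q X0 p (q + e).
    by apply: (good_exponents_le H _ _ G); rewrite /q; lra.
  have bq : beta <= q by rewrite /q; lra.
  have [B [B0 EB]] : exists B, 0 <= B /\ weight_moment P N T q = B%:E.
    apply: Ex_EFin; first by move=> w; exact: pow_sum_ge0.
    apply: (@weight_moment_lty _ _ _ P N T mNN mTT beta q s) => //; rewrite ?Eb ?ltry //.
      exact: ltW.
    by rewrite /q; lra.
  have [||B1 [m1 [Em1 m1B]]] := @weight_moment_lt q (q - e) B bq _ _ EB; try (rewrite /q; lra).
  have eq : e < q by rewrite /q; lra.
  apply: (notF (q + e)); [rewrite /q; lra|rewrite /q; lra|].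
  apply: (moment_step H HL e0 eq G1 EB Em1 B1 m1B).
  by apply: below; rewrite /q; lra.
Qed.

End extension.

(** * Thresholds and the dichotomy *)

Section model_of_solution.
Context d (Om : measurableType d) (R : realType) (P : probability Om R).
Context (Q : {RV P >-> R}) (T : nat -> {RV P >-> R}) (X : {RV P >-> R})
  (Xs : nat -> {RV P >-> R}).

Definition generators (I : Type) (Y : I -> {RV P >-> R}) : set (set Om) :=
  \bigcup_i preimage_set_system setT (Y i) measurable.

Lemma generators_measurable I (Y : I -> {RV P >-> R}) : generators Y `<=` measurable.
Proof.
by move=> A [i _ [B mB <-]]; exact: (measurable_funP (Y i)).
Qed.

Lemma measurable_generators I (Y : I -> {RV P >-> R}) i :
  measurable_fun setT (Y i : g_sigma_algebraType (generators Y) -> R).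
Proof. by move=> _ B mB; apply: sub_sigma_algebra; exists i => //; exists B. Qed.

Lemma solution_model : is_solution Q T X Xs ->
  weighted_model P (generators (QT_family Q T)) (generators Xs) (Ncount T)
    (fun k => T k) (fun k => Xs k) Q X.
Proof.
case=> -[law ind] fam _; split.
- by split; [exact: generators_measurable|exact: generators_measurable|exact: fam].
- have mT k : measurable_fun setT
      (T k : g_sigma_algebraType (generators (QT_family Q T)) -> R).
    by have := @measurable_generators _ (QT_family Q T) (Some k).
  split => //; first exact: (@measurable_count_of _ _ R _ mT).
  by have := @measurable_generators _ (QT_family Q T) None.
- by split => // k; exact: measurable_generators.
- move=> j k A B jk mA mB.
  have kj : (k == j) = false by apply/eqP => e; apply: jk.
  have := ind [:: j; k] (fun i => if i == j then A else B).
  rewrite /= inE eq_sym kj => /(_ erefl) h.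
  have {}h := h (fun i => ltac:(by case: ifP)).
  rewrite !big_cons big_nil mule1 eqxx kj in h.
  rewrite -h; congr (P _); apply/seteqP; split => w /=.
    move=> [wA wB] i /=; rewrite !inE => /orP[/eqP->|/eqP->]; first by rewrite eqxx.
    by rewrite kj.
  move=> hw; split.
    by have := hw j; rewrite /= eqxx; apply; rewrite !inE eqxx.
  by have := hw k; rewrite /= kj; apply; rewrite !inE eqxx orbT.
Qed.

Lemma ordered_weights_zero : ordered_weights T ->
  {ae P, forall w, forall k, (Ncount T w <= k)%N -> T k w = 0}.
Proof.
by apply: filterS => w [_ _ _ h] k /h /eqP; rewrite normr_eq0 => /eqP.
Qed.

End model_of_solution.

Section finiteness_thresholds.
Context d (Om : measurableType d) (R : realType) (P : probability Om R).
Context (T : nat -> {RV P >-> R}).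
Implicit Types s p e : R.

Let mN : measurable_count (Ncount T).
Proof. by apply: (@measurable_count_of _ _ R (fun k => T k)). Qed.

Let W p w : R := pow_sum (Ncount T w) (fun k => `|T k w|) p.

Let W0 p w : 0 <= W p w. Proof. exact: pow_sum_ge0. Qed.
Let mW p : measurable_fun setT (W p). Proof. exact: measurable_W. Qed.
Let mWr p r : measurable_fun setT (fun w => W p w `^ r).
Proof. exact: measurable_fun_powR. Qed.

Lemma muE s : mu T s = 'E_P[fun w => (W 1 w `^ s)%R]%E.
Proof.
apply: eq_Ex => w; congr (_ `^ _); apply: eq_bigr => k _; by rewrite powRr1.
Qed.

Lemma m_epsE e s : m_eps T e s = 'E_P[fun w => (W s w `^ (1 + e))%R]%E.
Proof. by []. Qed.

Lemma mE s : m T s = 'E_P[W s]%E. Proof. by []. Qed.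

Lemma m_lty_of_mu s : 1 <= s -> (mu T s < +oo)%E -> (m T s < +oo)%E.
Proof.
move=> s1; rewrite muE mE; apply: Ex_lty_le => // w.
rewrite /W /pow_sum; under [in leRHS]eq_bigr do rewrite powRr1 //.
by apply: (@powR_sum_superadd R _ (fun k => `|T k w|)).
Qed.

Lemma m_lty_of_m_eps e s : 0 < e -> (m_eps T e s < +oo)%E -> (m T s < +oo)%E.
Proof.
move=> e0; rewrite m_epsE mE => h.
have : ('E_P[fun w => (W s w `^ 1)%R] < +oo)%E.
  apply: (Ex_powR_lty_le (mW s) (W0 s) _ _ h); lra.
by apply: Ex_lty_le => // w; rewrite powRr1.
Qed.

Lemma m_eps_lty_anti e e' s : 0 < e -> e <= e' -> (m_eps T e' s < +oo)%E ->
  (m_eps T e s < +oo)%E.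
Proof.
move=> e0 ee; rewrite !m_epsE => h.
apply: (Ex_powR_lty_le (mW s) (W0 s) _ _ h); lra.
Qed.

Lemma m_eps_lty_between e a s b : 0 < e -> 0 <= a -> a <= s -> s <= b ->
  (m_eps T e a < +oo)%E -> (m_eps T e b < +oo)%E -> (m_eps T e s < +oo)%E.
Proof.
move=> e0 a0 as_ sb; rewrite !m_epsE => ha hb.
apply: (@Ex_lty_le _ _ _ _ _ (fun w => 2 `^ (1 + e) * (W a w `^ (1 + e) + W b w `^ (1 + e)))).
- exact: mWr.
- by apply: measurable_funM => //; exact: measurable_funD.
- by move=> w; exact: powR_ge0.
- move=> w; rewrite (le_trans _ (powR_add_le _ _ _)) //; last lra.
  rewrite ge0_ler_powR ?nnegrE ?addr_ge0 //; first lra.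
  rewrite -big_split /=; apply: ler_sum => k _; exact: powR_le_sum.
apply: Ex_lty_scale; rewrite ?powR_ge0 //.
- exact: measurable_funD.
- by move=> w; rewrite addr_ge0 ?powR_ge0.
by apply: (Ex_lty_add (mWr a (1 + e)) (mWr b (1 + e)) _ _ ha hb) => w; exact: powR_ge0.
Qed.

Lemma mu_lty_le s s' : 0 <= s -> s <= s' -> (mu T s' < +oo)%E -> (mu T s < +oo)%E.
Proof. by move=> s0 ss; rewrite !muE; exact: (Ex_powR_lty_le (mW 1) (W0 1)). Qed.

Lemma lt_s_1 s s' : s < s' -> 0 <= s' -> (m T s' < +oo)%E -> (s%:E < s_1 T)%E.
Proof.
move=> ss s0 ms; apply: (@lt_le_trans _ _ s'%:E); first by rewrite lte_fin.
by apply: ereal_sup_ubound; exists s'.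
Qed.

Lemma s_eps_anti e e' : 0 < e -> e <= e' -> (s_eps T e' <= s_eps T e)%E.
Proof.
move=> e0 ee; apply: le_ereal_sup => _ [s [s0 hs] <-]; exists s => //; split => //.
exact: m_eps_lty_anti hs.
Qed.

(** The thresholds [s_eps] increase as [e] decreases to 0, so that their limit
    is a supremum. *)
Lemma lt_lim_s_eps (x : \bar R) e0 : 0 < e0 ->
  (x < lim (s_eps T e @[e --> (0 : R)^'+]))%E ->
  exists e, [/\ 0 < e, e <= e0 & (x < s_eps T e)%E].
Proof.
move=> e00.
have hm : {in `]0, +oo[ &, nonincreasing_fun (s_eps T)}.
  by move=> a b; rewrite !in_itv /= !andbT => a0 b0 abb; exact: s_eps_anti.
have cv := @nonincreasing_at_right_cvge R (s_eps T) 0 +oo%O isT hm.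
rewrite (cvg_lim _ cv) // => /ereal_sup_gt [_ [e /= + <-] xe].
rewrite in_itv /= andbT => epos.
exists (Num.min e e0); split; first by rewrite lt_min epos.
  by rewrite ge_min lexx orbT.
apply: (lt_le_trans xe); apply: s_eps_anti; first by rewrite lt_min epos.
by rewrite ge_min lexx.
Qed.

(** Above order 1 the choice [p = 1] works, since the moments of
    [\sum_k |T k|] are finite up to [s_infty T]. *)
Lemma exponents_large (Q : {RV P >-> R})
    (HQ : forall s : R, 0 <= s -> (s%:E < s_1 T)%E -> (abs_moment Q s < +oo)%E) S :
  1 < S -> (S%:E < s_infty T)%E -> exists p s, [/\ S < s, 0 < p, p <= 1, p < S &
    [/\ s - p < S, ('E_P[fun w => (W p w `^ (s / p))%R] < +oo)%E &
        ('E_P[fun w => (`|Q w| `^ s)%R] < +oo)%E]].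
Proof.
move=> S1 /ereal_sup_gt [_ [s' [s'0 hs'] <-]]; rewrite lte_fin => Ss'.
pose s := Num.min ((S + s') / 2) (S + 1 / 2).
have s1 : S < s by rewrite lt_min ltrDl divr_gt0 // andbT ltr_pdivlMr //; lra.
have s2 : s <= (S + s') / 2 by rewrite ge_min lexx.
have s3 : s <= S + 1 / 2 by rewrite ge_min lexx orbT.
have ss' : s < s' by lra.
exists 1, s; split => //; split; first lra.
  rewrite divr1 -muE; apply: mu_lty_le hs'; lra.
apply: HQ; first lra.
apply: (lt_s_1 ss' s'0); apply: m_lty_of_mu hs'; lra.
Qed.

(** Up to order 1 an exponent [p] slightly below [S] is taken; then [s / p] is
    close to 1, hence at most [1 + e]. *)
Lemma exponents_small (Q : {RV P >-> R})
    (HQ : forall s : R, 0 <= s -> (s%:E < s_1 T)%E -> (abs_moment Q s < +oo)%E)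
    S a s' e : 0 < S -> S <= 1 -> 0 < e -> a < S -> S < s' -> (m T s' < +oo)%E ->
  (forall p, a <= p -> p < S -> (m_eps T e p < +oo)%E) ->
  exists p s, [/\ S < s, 0 < p, p <= 1, p < S &
    [/\ s - p < S, ('E_P[fun w => (W p w `^ (s / p))%R] < +oo)%E &
        ('E_P[fun w => (`|Q w| `^ s)%R] < +oo)%E]].
Proof.
move=> S0 S1 e0 aS Ss' ms' hp.
pose b := Num.max a (S / (1 + e)).
have bS : b < S.
  by rewrite gt_max aS ltr_pdivrMr ?addr_gt0 // ltr_pMr // ltrDl.
have ba : a <= b by rewrite le_max lexx.
have bSe : S / (1 + e) <= b by rewrite le_max lexx orbT.
have bp : 0 < b by rewrite (lt_le_trans _ bSe) // divr_gt0 // addr_gt0.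
pose p := (b + S) / 2.
have pS : p < S by rewrite /p; lra.
have pb : b < p by rewrite /p; lra.
have p0 : 0 < p by lra.
have pe : S < p * (1 + e).
  by rewrite -ltr_pdivrMr ?addr_gt0 // (le_lt_trans bSe).
pose s := Num.min (Num.min ((S + s') / 2) (p * (1 + e))) (S + p / 2).
have s1 : S < s.
  rewrite !lt_min pe andbT ltrDl divr_gt0 // andbT ltr_pdivlMr //; lra.
have s2 : s <= (S + s') / 2 by rewrite !ge_min lexx.
have s3 : s <= p * (1 + e) by rewrite !ge_min lexx orbT.
have s4 : s <= S + p / 2 by rewrite !ge_min lexx !orbT.
have s0 : 0 <= s by lra.
exists p, s; split => //; first lra.
split; first lra.
  have ap : a <= p by lra.
  have := hp p ap pS; rewrite m_epsE => h.
  apply: (Ex_powR_lty_le (mW p) (W0 p) _ _ h).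
    by rewrite divr_ge0 // ltW.
  by rewrite ler_pdivrMr // mulrC.
apply: HQ => //; apply: (lt_s_1 _ _ ms'); lra.
Qed.

End finiteness_thresholds.

Theorem theorem3p1 (d : measure_display) (Om : measurableType d)
    (R : realType) (P : probability Om R)
    (Q : {RV P >-> R}) (T : nat -> {RV P >-> R})
    (alpha beta r : R)
    (X : {RV P >-> R}) (Xs : nat -> {RV P >-> R})
    (HT : ordered_weights T)
    (Hs0 : (s_0 T < alpha%:E)%E) (Hab : alpha < beta)
    (Hs1 : (beta%:E < s_1 T)%E)
    (Hma : m T alpha = 1%E) (Hmb : m T beta = 1%E)
    (HQ0 : {ae P, forall w, Q w = 0} -> 1 <= alpha < 2)
    (HQ1 : (P [set w | Q w = 0%R] < 1)%E -> 0 < alpha < 2)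
    (Hneg : exists j, (0 < P [set w | (T j w < 0)%R])%E)
    (Hnonlat : exists k, nonlattice (log_weight_measure T k))
    (HQ : forall s : R, 0 <= s -> (s%:E < s_1 T)%E ->
       (abs_moment Q s < +oo)%E)
    (Hr : 1 <= alpha ->
       r%:E = (r%:E * 'E_P[fun w => (\sum_(k < Ncount T w) T k w)%R]
               + 'E_P[Q])%E)
    (HX : is_solution Q T X Xs)
    (HXmom : forall s : R, 0 <= s -> s < beta -> (abs_moment X s < +oo)%E)
    (HXmean : 1 <= alpha -> ('E_P[X] = r%:E)%E) :
  [/\ (1 < beta -> (beta%:E < s_infty T)%E ->
         (0 < Kconst T X Xs beta)%E \/
         (forall s : R, 0 <= s -> (s%:E < s_infty T)%E ->
            (abs_moment X s < +oo)%E)),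
      (beta <= 1 -> (beta%:E < s_infty T)%E ->
         (exists delta0 eps0 : R, [/\ 0 < delta0, 0 < eps0 &
            `[beta - delta0, 1] `<=` D_eps T eps0]) ->
         (0 < Kconst T X Xs beta)%E \/
         (forall s : R, 0 <= s -> (s%:E < s_infty T)%E ->
            (abs_moment X s < +oo)%E)) &
      (beta < 1 ->
         (exists delta0 eps0 : R, [/\ 0 < delta0, 0 < eps0 &
            `[beta - delta0, beta] `<=` D_eps T eps0]) ->
         (0 < Kconst T X Xs beta)%E \/
         (forall s : R, 0 <= s -> (s%:E < hat_s_infty T)%E ->
            (abs_moment X s < +oo)%E))].
Proof.
have alpha0 : 0 < alpha.
  rewrite -lte_fin; apply: le_lt_trans Hs0; apply: le_ereal_inf_tmp => _ [s [s0 _] <-].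
  by rewrite lee_fin.
have beta0 : 0 < beta by exact: lt_trans Hab.
have H := solution_model HX.
have HN := ordered_weights_zero HT.
have HL : eq_in_law P X (fun w => \sum_(k < Ncount T w) T k w * Xs k w + Q w) by case: HX.
have ext := fun HK => moments_extend H HL HN alpha0 Hab Hma Hmb Hnonlat HXmom HK.
have dich (U : \bar R) :
  (forall S, beta <= S -> (S%:E < U)%E -> exists p s, [/\ S < s, 0 < p, p <= 1, p < S &
     [/\ s - p < S,
       ('E_P[fun w => (pow_sum (Ncount T w) (fun k => `|T k w|) p `^ (s / p))%R] < +oo)%E &
       ('E_P[fun w => (`|Q w| `^ s)%R] < +oo)%E]]) ->
  (0 < Kconst T X Xs beta)%E \/
    (forall s : R, 0 <= s -> (s%:E < U)%E -> (abs_moment X s < +oo)%E).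
  move=> HU; have [K0|K0] := pselect (0 < Kconst T X Xs beta)%E; first by left.
  by right; exact: ext K0 U HU.
split.
- move=> beta1 _; apply: dich => S bS SU.
  by apply: exponents_large => //; exact: lt_le_trans bS.
- move=> beta1 _ [d0 [e0 [d00 e00 HD]]]; apply: dich => S bS SU.
  have [S1|S1] := ltP 1 S; first exact: exponents_large.
  have D1 : D_eps T e0 1 by apply: HD; rewrite /= in_itv /= lexx andbT; lra.
  have S0 : 0 < S by lra.
  have dS : beta - d0 < S by lra.
  have Se : S < 1 + e0 by lra.
  have me : (m T (1 + e0) < +oo)%E.
    apply: m_lty_of_mu; first lra.
    by rewrite muE; case: D1 => _; rewrite m_epsE.
  apply: (exponents_small HQ S0 S1 e00 dS Se me).
  move=> p pa pS; have [|_ //] := HD p.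
  by rewrite /= in_itv /=; apply/andP; split => //; lra.
- move=> beta1 [d0 [e0 [d00 e00 HD]]]; apply: dich => S bS.
  rewrite lt_min lte_fin => /andP[S1 /(lt_lim_s_eps e00) [e [epos ee]]].
  move=> /ereal_sup_gt [_ [s' [s'0 hs'] <-]]; rewrite lte_fin => Ss'.
  have [ld0 hl] : D_eps T e0 (beta - d0) by apply: HD; rewrite /= in_itv /= lexx /=; lra.
  have S0 : 0 < S by lra.
  have dS : beta - d0 < S by lra.
  apply: (exponents_small HQ S0 (ltW S1) epos dS Ss' (m_lty_of_m_eps epos hs')).
  move=> p pa pS; apply: (m_eps_lty_between epos ld0 pa _ _ hs'); first lra.
  exact: m_eps_lty_anti hl.
Qed.
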